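(* Let $\mathbf{k}$ be a field of characteristic $0$, let $\lambda\in\mathbf{k}^\times$ and let $\Phi\in\mathbf{Assoc}_\lambda(\mathbf{k})$. Then there exists a unique sequence $(\zeta_\Phi(n))_{n\geq2}$ of elements of $\mathbf{k}$ such that $$(1+\Phi_B B)^{\mathrm{ab}}=\frac{\Gamma_\Phi(\overline A+\overline B)}{\Gamma_\Phi(\overline A)\,\Gamma_\Phi(\overline B)},$$ where $\Gamma_\Phi$ is the invertible formal series $\Gamma_\Phi(u)=\exp\left(-\sum_{n\geq2}\zeta_\Phi(n)u^n/n\right)$. Moreover $\zeta_\Phi(n)=\lambda^n r_n$ for $n$ even.
   Context: $\mathfrak{f}_2(A,B)$ is the free Lie algebra over $\mathbf{k}$ on $A,B$, with $A,B$ of degree $1$, and $\widehat F_2$ is the degree completion of $U(\mathfrak{f}_2(A,B))$, i.e. the algebra of noncommutative formal power series in $A,B$, with its topological coproduct $\Delta$ for which $A,B$ are primitive and its counit $\varepsilon$. For $n\ge 2$, $\mathfrak{t}_n$ is the Lie algebra over $\mathbf{k}$ with generators $t_{ij}$ ($i\neq j\in\{1,\dots,n\}$) and relations $t_{ij}=t_{ji}$, $[t_{ij}+t_{ik},t_{jk}]=0$ for $i,j,k$ distinct, $[t_{ij},t_{kl}]=0$ for $i,j,k,l$ all distinct. If $I_1,\dots,I_n$ are disjoint subsets of $\{1,\dots,m\}$, the morphism $x\mapsto x^{I_1,\dots,I_n}$ is the Lie algebra morphism $\mathfrak{t}_n\to\mathfrak{t}_m$, $t_{ij}\mapsto\sum_{\alpha\in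 I_i,\beta\in I_j}t_{\alpha\beta}$, extended to (degree completions of) enveloping algebras; a subset such as $\{1,2\}$ is written $12$. One identifies $A=t_{12}$, $B=t_{23}$, which embeds $\mathfrak{f}_2(A,B)$ in $\mathfrak{t}_3$. For $\lambda\in\mathbf{k}^\times$, $\mathbf{Assoc}_\lambda(\mathbf{k})$ is the set of all $\Phi\in\widehat F_2^\times$ such that (1) $\Delta(\Phi)=\Phi\otimes\Phi$; (2) $\Phi(A,B)e^{\lambda A/2}\Phi(C,A)e^{\lambda C/2}\Phi(B,C)e^{\lambda B/2}=1$ where $C=-A-B$; (3) $\Phi^{2,3,4}\Phi^{1,23,4}\Phi^{1,2,3}=\Phi^{1,2,34}\Phi^{12,3,4}$ in the degree completion of $U(\mathfrak{t}_4)$. For $X\in\widehat F_2$, $(X_A,X_B)$ is the unique pair of elements of $\widehat F_2$ such that $X=\varepsilon(X)1+X_AA+X_BB$. The map $X\mapsto X^{\mathrm{ab}}$ is the unique continuous algebra morphism $\widehat F_2\to\mathbf{k}[[\overline A,\overline B]]$ (commutative power series) with $A\mapsto\overline A$, $B\mapsto\overline B$. For $n\geq 2$ even, $r_n=-B_n/(2\,n!)\in\mathbb{Q}$, where the Bernoulli numbers $B_k$ are defined by $u/(e^u-1)=\sum_{k\ge0}B_ku^k/k!$ (so $\zeta(n)=(2\pi i)^nr_n$). *)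

(* Defs.v *)
From HB Require Import structures.
From mathcomp Require Import all_boot all_order all_algebra.
From mathcomp Require Import boolp.

Set Implicit Arguments.
Unset Strict Implicit.
Unset Printing Implicit Defensive.

Import GRing.Theory.
Local Open Scope ring_scope.

(* Monoids of monomials. [facts m] lists the finitely many factorizations of  *)
(* [m], so that the product of two arbitrary functions [M -> k] makes sense.  *)
HB.mixin Record Monoid_isGraded M of Monoid M := {
  deg : M -> nat;
  facts : M -> seq (M * M);
  degM : forall x y : M, deg (x * y)%g = (deg x + deg y)%N;
  deg_eq0 : forall x : M, deg x = 0%N -> x = 1%g;
  facts_uniq : forall x : M, uniq (facts x);
  mem_facts : forall (x : M) p, (p \in facts x) = ((p.1 * p.2)%g == x)
}.

#[short(type="gradedMonoidType")]
HB.structure Definition GradedMonoid := {M of Monoid_isGraded M & Monoid M}.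

Lemma deg1 (M : gradedMonoidType) : deg (1%g : M) = 0%N.
Proof.
by have /eqP := degM (1%g : M) 1%g; rewrite mul1g -{1}[deg _]addn0 eqn_add2l => /eqP.
Qed.

Definition word (I : Type) : Type := seq I.

Section Word.
Variable I : choiceType.
HB.instance Definition _ := Choice.on (word I).

Fact cat_wordA : associative (fun u v : word I => u ++ v).
Proof. exact: catA. Qed.
Fact cat_word1 : left_id ([::] : word I) (fun u v : word I => u ++ v).
Proof. exact: cat0s. Qed.
Fact word_cat1 : right_id ([::] : word I) (fun u v : word I => u ++ v).
Proof. exact: cats0. Qed.
HB.instance Definition _ :=
  isMonoid.Build (word I) cat_wordA cat_word1 word_cat1.

Definition word_facts (w : word I) : seq (word I * word I) :=
  [seq (take i w, drop i w) | i <- iota 0 (size w).+1].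

Fact word_degM (x y : word I) : size (x * y)%g = (size x + size y)%N.
Proof. exact: size_cat. Qed.

Fact word_deg_eq0 (x : word I) : size x = 0%N -> x = 1%g.
Proof. exact: size0nil. Qed.

Fact word_facts_uniq (w : word I) : uniq (word_facts w).
Proof.
rewrite map_inj_in_uniq ?iota_uniq // => i j.
rewrite !mem_iota !add0n !ltnS /= => hi hj [h _].
by move: (congr1 size h); rewrite !size_takel.
Qed.

Fact mem_word_facts (w : word I) p :
  (p \in word_facts w) = ((p.1 * p.2)%g == w).
Proof.
apply/mapP/eqP => [[i _ ->]|<-]; first exact: cat_take_drop.
case: p => u v; exists (size u).
  by rewrite mem_iota add0n ltnS word_degM; exact: leq_addr.
by rewrite /= take_size_cat // drop_size_cat.
Qed.

HB.instance Definition _ := Monoid_isGraded.Build (word I)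
  word_degM word_deg_eq0 word_facts_uniq mem_word_facts.
End Word.

(* [nat] as the multiplicative monoid of the powers of one variable *)
Definition expo : Type := nat.
HB.instance Definition _ := Choice.on expo.
HB.instance Definition _ := isMonoid.Build expo addnA add0n addn0.

Definition expo_facts (n : expo) : seq (expo * expo) :=
  [seq (i, (n - i)%N) | i <- iota 0 n.+1].

Fact expo_facts_uniq n : uniq (expo_facts n).
Proof. by rewrite map_inj_uniq ?iota_uniq // => i j []. Qed.

Fact mem_expo_facts (n : expo) (p : expo * expo) :
  (p \in expo_facts n) = ((p.1 * p.2)%g == n).
Proof.
apply/mapP/eqP => [[i]|<-].
  by rewrite mem_iota add0n ltnS => /= hi -> /=; exact: subnKC.
case: p => a b; exists a; first by rewrite mem_iota add0n ltnS; exact: leq_addr.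
by congr (_, _); exact/esym/addKn.
Qed.

HB.instance Definition _ := Monoid_isGraded.Build expo
  (deg := id) (fun _ _ => erefl) (fun _ => id) expo_facts_uniq mem_expo_facts.

Definition prodm (M N : Type) : Type := (M * N)%type.

Section ProdMonoid.
Variables M N : gradedMonoidType.
HB.instance Definition _ := Choice.on (prodm M N).

Definition prodm_mul (x y : prodm M N) : prodm M N :=
  ((x.1 * y.1)%g, (x.2 * y.2)%g).
Fact prodm_mulA : associative prodm_mul.
Proof. by move=> x y z; rewrite /prodm_mul !mulgA. Qed.
Fact prodm_mul1 : left_id ((1, 1)%g : prodm M N) prodm_mul.
Proof. by case=> x y; rewrite /prodm_mul !mul1g. Qed.
Fact prodm_mulr1 : right_id ((1, 1)%g : prodm M N) prodm_mul.
Proof. by case=> x y; rewrite /prodm_mul !mulg1. Qed.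
HB.instance Definition _ :=
  isMonoid.Build (prodm M N) prodm_mulA prodm_mul1 prodm_mulr1.

Definition prodm_facts (x : prodm M N) : seq (prodm M N * prodm M N) :=
  [seq ((p.1, q.1), (p.2, q.2)) | p <- facts x.1, q <- facts x.2].

Fact prodm_degM (x y : prodm M N) :
  (deg (x * y)%g.1 + deg (x * y)%g.2 =
   (deg x.1 + deg x.2) + (deg y.1 + deg y.2))%N.
Proof. by rewrite /= !degM addnACA. Qed.

Fact prodm_deg_eq0 (x : prodm M N) : (deg x.1 + deg x.2 = 0)%N -> x = 1%g.
Proof.
by case: x => x y /= /eqP; rewrite addn_eq0 => /andP[/eqP/deg_eq0 -> /eqP/deg_eq0 ->].
Qed.

Fact prodm_facts_uniq x : uniq (prodm_facts x).
Proof.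
apply: allpairs_uniq; rewrite ?facts_uniq //.
by move=> [[a b] [c d]] [[a' b'] [c' d']] _ _ /= [-> -> -> ->].
Qed.

Fact mem_prodm_facts (x : prodm M N) p :
  (p \in prodm_facts x) = ((p.1 * p.2)%g == x).
Proof.
apply/allpairsP/eqP => [[[q r]] /= [hq hr ->]|<-].
  by case: x hq hr => x y; rewrite !mem_facts /= => /eqP <- /eqP <-.
case: p => [[a b] [c d]] /=; exists ((a, c), (b, d)).
by rewrite /= !mem_facts /= !eqxx.
Qed.

HB.instance Definition _ := Monoid_isGraded.Build (prodm M N)
  prodm_degM prodm_deg_eq0 prodm_facts_uniq mem_prodm_facts.
End ProdMonoid.

(* Formal power series with coefficients in k and monomials in M:             *)
(* - [fps k (word I)]: noncommutative series k<<I>>;                          *)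
(* - [fps k (prodm (word I) (word I))]: the completed tensor square of it;    *)
(* - [fps k expo] and [fps k (prodm expo expo)]: k[[u]] and k[[a, b]].        *)
Definition fps (k : Type) (M : Type) : Type := M -> k.

Section FpsRing.
Variables (k : fieldType) (M : gradedMonoidType).
Implicit Types f g h : fps k M.

HB.instance Definition _ := gen_eqMixin (fps k M).
HB.instance Definition _ := gen_choiceMixin (fps k M).

Lemma fpsP f g : (forall m, f m = g m) <-> f = g.
Proof. by split=> [h|-> //]; apply/funext. Qed.

Definition fps_zero : fps k M := fun=> 0.
Definition fps_opp f : fps k M := fun m => - f m.
Definition fps_add f g : fps k M := fun m => f m + g m.

Fact fps_addA : associative fps_add.
Proof. by move=> f g h; apply/fpsP => m; rewrite /fps_add addrA. Qed.
Fact fps_addC : commutative fps_add.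
Proof. by move=> f g; apply/fpsP => m; rewrite /fps_add addrC. Qed.
Fact fps_add0 : left_id fps_zero fps_add.
Proof. by move=> f; apply/fpsP => m; rewrite /fps_add add0r. Qed.
Fact fps_addN : left_inverse fps_zero fps_opp fps_add.
Proof. by move=> f; apply/fpsP => m; rewrite /fps_add addNr. Qed.
HB.instance Definition _ :=
  GRing.isZmodule.Build (fps k M) fps_addA fps_addC fps_add0 fps_addN.

Definition mono (m : M) : fps k M := fun m' => (m' == m)%:R.

Definition fps_mul f g : fps k M :=
  fun m => \sum_(p <- facts m) f p.1 * g p.2.

Fact fps_mulA : associative fps_mul.
Proof.
move=> f g h; apply/fpsP => m; rewrite /fps_mul.
under eq_bigr do rewrite mulr_sumr.
under [RHS]eq_bigr do rewrite mulr_suml.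
pose F (x : M * M * M) := f x.1.1 * g x.1.2 * h x.2.
transitivity (\sum_(x <- [seq (p.1, q.1, q.2) | p <- facts m, q <- facts p.2]) F x).
  rewrite big_allpairs_dep; apply: eq_bigr => p _; apply: eq_bigr => q _.
  by rewrite mulrA.
rewrite -(@big_allpairs_dep _ _ _ _ _ _ (fun p q => (q.1, q.2, p.2)) _ (fun p => facts p.1) F).
apply/perm_big/uniq_perm.
- apply: allpairs_uniq_dep => [|x _|]; rewrite ?facts_uniq //.
  move=> x y /allpairsPdep[[a b] [[c d] [_ hq ->{x}]]].
  move=> /allpairsPdep[[a' b'] [[c' d'] [_ hq' ->{y}]]] /= [? ? ?].
  move: hq hq'; rewrite !mem_facts /= => /eqP hq /eqP hq'; subst.
  by [].
- apply: allpairs_uniq_dep => [|x _|]; rewrite ?facts_uniq //.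
  move=> x y /allpairsPdep[[a b] [[c d] [_ hq ->{x}]]].
  move=> /allpairsPdep[[a' b'] [[c' d'] [_ hq' ->{y}]]] /= [? ? ?].
  move: hq hq'; rewrite !mem_facts /= => /eqP hq /eqP hq'; subst.
  by [].
move=> [[a b] c]; apply/allpairsPdep/allpairsPdep.
  move=> [p [q [+ + [-> -> ->]]]]; rewrite !mem_facts => /eqP <- /eqP <-.
  by exists ((p.1 * q.1)%g, q.2), (p.1, q.1); rewrite !mem_facts /= mulgA !eqxx.
move=> [p [q [+ + [-> -> ->]]]]; rewrite !mem_facts => /eqP <- /eqP <-.
by exists (q.1, (q.2 * p.2)%g), (q.2, p.2); rewrite !mem_facts /= mulgA !eqxx.
Qed.

Fact fps_mul1 : left_id (mono 1%g) fps_mul.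
Proof.
move=> f; apply/fpsP => m; rewrite /fps_mul /mono.
rewrite (bigD1_seq (1%g, m)) ?facts_uniq ?mem_facts ?mul1g //= eqxx mul1r.
rewrite big1_seq ?addr0 // => -[a b] /= /andP[ne].
rewrite mem_facts /= => /eqP e; case: eqP => [a1|_]; last by rewrite mul0r.
by rewrite -e a1 mul1g eqxx in ne.
Qed.
Fact fps_mulr1 : right_id (mono 1%g) fps_mul.
Proof.
move=> f; apply/fpsP => m; rewrite /fps_mul /mono.
rewrite (bigD1_seq (m, 1%g)) ?facts_uniq ?mem_facts ?mulg1 //= eqxx mulr1.
rewrite big1_seq ?addr0 // => -[a b] /= /andP[ne].
rewrite mem_facts /= => /eqP e; case: eqP => [b1|_]; last by rewrite mulr0.
by rewrite -e b1 mulg1 eqxx in ne.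
Qed.
Fact fps_mulDl : left_distributive fps_mul fps_add.
Proof.
move=> f g h; apply/fpsP => m; rewrite /fps_mul /fps_add -big_split.
by apply: eq_bigr => p _; rewrite mulrDl.
Qed.
Fact fps_mulDr : right_distributive fps_mul fps_add.
Proof.
move=> f g h; apply/fpsP => m; rewrite /fps_mul /fps_add -big_split.
by apply: eq_bigr => p _; rewrite mulrDr.
Qed.
Fact fps_oner_neq0 : mono 1%g != 0 :> fps k M.
Proof.
apply/eqP => /fpsP /(_ 1%g); rewrite /mono eqxx => /eqP.
by rewrite oner_eq0.
Qed.
HB.instance Definition _ := GRing.Zmodule_isNzRing.Build (fps k M)
  fps_mulA fps_mul1 fps_mulr1 fps_mulDl fps_mulDr fps_oner_neq0.

Definition fps_scale (c : k) f : fps k M := fun m => c * f m.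
Fact fps_scaleA a b f : fps_scale a (fps_scale b f) = fps_scale (a * b) f.
Proof. by apply/fpsP => m; rewrite /fps_scale mulrA. Qed.
Fact fps_scale1 : left_id 1 fps_scale.
Proof. by move=> f; apply/fpsP => m; rewrite /fps_scale mul1r. Qed.
Fact fps_scaleDr : right_distributive fps_scale +%R.
Proof. by move=> a f g; apply/fpsP => m; rewrite /fps_scale mulrDr. Qed.
Fact fps_scaleDl f : {morph fps_scale^~ f : a b / a + b}.
Proof. by move=> a b; apply/fpsP => m; rewrite /fps_scale mulrDl. Qed.
HB.instance Definition _ := GRing.Zmodule_isLmodule.Build k (fps k M)
  fps_scaleA fps_scale1 fps_scaleDr fps_scaleDl.

Fact fps_scaleAl (a : k) f g : a *: (f * g) = (a *: f) * g.
Proof.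
apply/fpsP => m.
change (a * (\sum_(p <- facts m) f p.1 * g p.2)
        = \sum_(p <- facts m) (a * f p.1) * g p.2).
by rewrite mulr_sumr; apply: eq_bigr => p _; rewrite mulrA.
Qed.
HB.instance Definition _ := GRing.Lmodule_isLalgebra.Build k (fps k M) fps_scaleAl.
Fact fps_scaleAr (a : k) f g : a *: (f * g) = f * (a *: g).
Proof.
apply/fpsP => m.
change (a * (\sum_(p <- facts m) f p.1 * g p.2)
        = \sum_(p <- facts m) f p.1 * (a * g p.2)).
by rewrite mulr_sumr; apply: eq_bigr => p _; rewrite mulrCA.
Qed.
HB.instance Definition _ := GRing.Lalgebra_isAlgebra.Build k (fps k M) fps_scaleAr.

Definition fps_unit : pred (fps k M) := fun f => `[< exists g, g * f = 1 /\ f * g = 1 >].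
Definition fps_inv f : fps k M :=
  if pselect (exists g, g * f = 1 /\ f * g = 1) is left h then projT1 (cid h) else f.

Fact fps_mulVr : {in fps_unit, left_inverse 1 fps_inv *%R}.
Proof.
move=> f /asboolP h; rewrite /fps_inv; case: pselect => // h'.
by case: (projT2 (cid h')).
Qed.
Fact fps_mulrV : {in fps_unit, right_inverse 1 fps_inv *%R}.
Proof.
move=> f /asboolP h; rewrite /fps_inv; case: pselect => // h'.
by case: (projT2 (cid h')).
Qed.
Fact fps_unitP f g : g * f = 1 /\ f * g = 1 -> fps_unit f.
Proof. by move=> h; apply/asboolP; exists g. Qed.
Fact fps_inv_out : {in [predC fps_unit], fps_inv =1 id}.
Proof.
move=> f /negP h; rewrite /fps_inv; case: pselect => // h'.
by case: h; apply/asboolP.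
Qed.
HB.instance Definition _ := GRing.NzRing_hasMulInverse.Build (fps k M)
  fps_mulVr fps_mulrV fps_unitP fps_inv_out.

Lemma coefD f g m : (f + g) m = f m + g m. Proof. by []. Qed.
Lemma coefN f m : (- f) m = - f m. Proof. by []. Qed.
Lemma coefZ (c : k) f m : (c *: f) m = c * f m. Proof. by []. Qed.
Lemma coefM f g m : (f * g) m = \sum_(p <- facts m) f p.1 * g p.2.
Proof. by []. Qed.
Lemma coef1 m : (1 : fps k M) m = (m == 1%g)%:R. Proof. by []. Qed.
Lemma coef_sum (J : Type) (r : seq J) (P : pred J) (F : J -> fps k M) m :
  (\sum_(j <- r | P j) F j) m = \sum_(j <- r | P j) F j m.
Proof. exact: (big_morph (fun f : fps k M => f m)). Qed.

End FpsRing.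

Arguments mono {k M} m.

Section Substitution.
Variables (k : fieldType) (M : gradedMonoidType).

(* c(x), for c in k[[u]] and x with zero constant term *)
Definition fps_eval (c : fps k expo) (x : fps k M) : fps k M :=
  fun m => \sum_(l < (deg m).+1) c (l : nat) * (x ^+ l) m.

Definition fps_exp (x : fps k M) : fps k M :=
  fps_eval (fun n : expo => (n`!%:R)^-1) x.

(* The continuous algebra morphism sending the letter i to [x i], when the    *)
(* [x i] have zero constant term: words longer than [deg m] then do not       *)
(* contribute to the coefficient of [m].                                      *)
Definition fps_subst (I : finType) (x : I -> fps k M) (S : fps k (word I)) :
    fps k M :=
  fun m => \sum_(l < (deg m).+1) \sum_(w : l.-tuple I)
    S (w : seq I) * (\prod_(i <- w) x i) m.

End Substitution.

Section Unit.
Variables (k : fieldType) (M : gradedMonoidType).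
Implicit Types x : fps k M.

Lemma facts1 : facts (1%g : M) = [:: (1%g, 1%g)].
Proof.
apply: perm_small_eq => //; apply: uniq_perm; rewrite ?facts_uniq //.
move=> [a b]; rewrite mem_facts inE /=; apply/eqP/eqP => [h|[-> ->]]; last exact: mul1g.
have := congr1 (@deg M) h; rewrite degM deg1 => /eqP; rewrite addn_eq0.
by move=> /andP[/eqP/deg_eq0 -> /eqP/deg_eq0 ->].
Qed.

Lemma coefM1 x y : (x * y) 1%g = x 1%g * y 1%g.
Proof. by rewrite coefM facts1 big_seq1. Qed.

Lemma coefX_gt x l (m : M) : x 1%g = 0 -> (deg m < l)%N -> (x ^+ l) m = 0.
Proof.
move=> x0; elim: l m => // l IH m hm; rewrite exprS coefM big1_seq // => -[a b] /=.
rewrite mem_facts /= => /eqP e.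
have [/deg_eq0 ->|ha] := eqVneq (deg a) 0%N; first by rewrite x0 mul0r.
rewrite IH ?mulr0 //; move: hm; rewrite -e degM ltnS; apply: leq_trans.
by rewrite -{1}[deg b]add0n ltn_add2r lt0n.
Qed.

Lemma fps_evalE (c : fps k expo) x n (m : M) : x 1%g = 0 -> (deg m <= n)%N ->
  fps_eval c x m = \sum_(l < n.+1) c (l : nat) * (x ^+ l) m.
Proof.
move=> x0 hm; rewrite /fps_eval -!(big_mkord xpredT (fun l : nat => c l * (x ^+ l) m)).
rewrite [RHS](@big_cat_nat _ _ _ (deg m).+1) //= [X in _ + X]big1_seq ?addr0 //.
move=> l /andP[_]; rewrite mem_index_iota => /andP[h _].
by rewrite coefX_gt ?mulr0.
Qed.

Lemma unit_fps x : (x \is a GRing.unit) = (x 1%g != 0).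
Proof.
apply/idP/idP => [/mulVr/(congr1 (fun f : fps k M => f 1%g))|x0].
  rewrite coefM1 coef1 eqxx /= => h; apply: contra_eq_neq h => ->.
  by rewrite mulr0 eq_sym oner_eq0.
pose y : fps k M := 1 - (x 1%g)^-1 *: x.
have y0 : y 1%g = 0 by rewrite /y coefD coefN coefZ coef1 eqxx mulVf // subrr.
have -> : x = (x 1%g) *: (1 - y).
  by rewrite /y opprB addrCA subrr addr0 scalerA mulfV // scale1r.
pose z : fps k M := fps_eval (fun=> 1) y.
have zE n (m : M) : (deg m <= n)%N -> z m = (\sum_(l < n.+1) y ^+ l) m.
  move=> hm; rewrite /z (fps_evalE _ y0 hm) coef_sum.
  by apply: eq_bigr => l _; rewrite mul1r.
have sub1 n (m : M) : (deg m <= n)%N -> (1 - y ^+ n.+1) m = (1 : fps k M) m.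
  by move=> hm; rewrite coefD coefN coefX_gt // oppr0 addr0.
have dfac (m : M) p : p \in facts m -> (deg p.1 <= deg m)%N /\ (deg p.2 <= deg m)%N.
  by rewrite mem_facts => /eqP <-; rewrite degM leq_addr leq_addl.
have geom n : (1 - y) * (\sum_(l < n) y ^+ l) = 1 - y ^+ n.
  by rewrite -[1 - y]opprB mulNr -subrX1 opprB.
have geomr n : (\sum_(l < n) y ^+ l) * (1 - y) = 1 - y ^+ n.
  elim: n => [|n IH]; first by rewrite big_ord0 mul0r expr0 subrr.
  by rewrite big_ord_recr mulrDl IH mulrBr mulr1 -exprSr addrA subrK.
have zl : (1 - y) * z = 1.
  apply/fpsP => m; rewrite -(sub1 _ _ (leqnn _)) -geom !coefM.
  by apply: eq_big_seq => p /dfac[_ hp]; rewrite (zE _ _ hp).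
have zr : z * (1 - y) = 1.
  apply/fpsP => m; rewrite -(sub1 _ _ (leqnn _)) -geomr !coefM.
  by apply: eq_big_seq => p /dfac[hp _]; rewrite (zE _ _ hp).
apply/unitrP; exists ((x 1%g)^-1 *: z).
by rewrite -!scalerAl -!scalerAr !scalerA mulVf // mulfV // !scale1r.
Qed.
End Unit.

Section MulMono.
Variables (k : fieldType) (M : gradedMonoidType).
Implicit Types f : fps k M.

Lemma coefM_mono f (c a x : M) : (a * c)%g = x ->
  (forall a', (a' * c)%g = x -> a' = a) -> (f * mono c) x = f a.
Proof.
move=> ex inj; rewrite coefM /mono.
rewrite (bigD1_seq (a, c)) ?facts_uniq ?mem_facts /= ?ex ?eqxx //= mulr1.
rewrite big1_seq ?addr0 // => -[a' c'] /= /andP[ne].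
rewrite mem_facts /= => /eqP e; case: eqP => [c1|_]; last by rewrite mulr0.
by move: ne; rewrite (inj a') -?c1 ?eqxx.
Qed.

Lemma coefM_mono0 f (c x : M) : (forall a, (a * c)%g <> x) -> (f * mono c) x = 0.
Proof.
move=> ninj; rewrite coefM /mono big1_seq // => -[a' c'] /=.
rewrite mem_facts /= => /eqP e; case: eqP => [c1|_]; last by rewrite mulr0.
by case: (ninj a'); rewrite -c1.
Qed.

Lemma fps_eval_const (c : fps k expo) f : fps_eval c f 1%g = c 0%N.
Proof.
by rewrite /fps_eval deg1 big_ord_recl big_ord0 addr0 expr0 coef1 eqxx mulr1.
Qed.

Lemma unit_fps_exp f : fps_exp f \is a GRing.unit.
Proof. by rewrite unit_fps /fps_exp fps_eval_const fact0 invr1 oner_eq0. Qed.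
End MulMono.

(* The completed algebra F_2^ = k<<A, B>>, over the letters A = false and     *)
(* B = true.                                                                  *)
Notation ncs k := (fps k (word bool)).

Section FreeAlgebra.
Variable k : fieldType.

Definition letter (I : choiceType) (i : I) : fps k (word I) :=
  mono ([:: i] : word I).

Definition serA : ncs k := letter false.
Definition serB : ncs k := letter true.

Definition counit (X : ncs k) : k := X 1%g.

(* X(x, y) *)
Definition subst2 (M : gradedMonoidType) (X : ncs k) (x y : fps k M) : fps k M :=
  fps_subst (fun b => if b then y else x) X.

Definition tensor (X Y : ncs k) : fps k (prodm (word bool) (word bool)) :=
  fun p => X p.1 * Y p.2.

Definition coproduct (X : ncs k) : fps k (prodm (word bool) (word bool)) :=
  subst2 X (tensor serA 1 + tensor 1 serA) (tensor serB 1 + tensor 1 serB).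

(* X_A and X_B, see [rpart_decomp] and [rpart_unique] *)
Definition rpart (b : bool) (X : ncs k) : ncs k := fun w => X (rcons w b).
Definition rpartA : ncs k -> ncs k := rpart false.
Definition rpartB : ncs k -> ncs k := rpart true.

Lemma coefM_letter (X : ncs k) b w : (X * letter b) (rcons w b) = X w.
Proof.
apply: coefM_mono => [|a]; first exact: cats1.
by move=> e; apply: (@rcons_injl _ b); rewrite -e; exact/esym/cats1.
Qed.

Lemma coefM_letter0 (X : ncs k) b : (X * letter b) [::] = 0.
Proof.
by apply: coefM_mono0 => a e; have := congr1 size e; rewrite [LHS]size_cat addn1.
Qed.

Lemma coefM_letterN (X : ncs k) b c w : b != c -> (X * letter b) (rcons w c) = 0.
Proof.
move=> ne; apply: coefM_mono0 => a e.
have : rcons a b = rcons w c by rewrite -e; exact/esym/cats1.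
by move=> /(congr1 (last b)); rewrite !last_rcons => /eqP; rewrite (negPf ne).
Qed.

Lemma rpart_unique (X Y Z : ncs k) (c : k) :
  X = c%:A + Y * serA + Z * serB -> Y = rpartA X /\ Z = rpartB X.
Proof.
move=> ->; split; apply/fpsP => w; rewrite /rpartA /rpartB /rpart !coefD coefZ.
  rewrite coefM_letter coefM_letterN // addr0 coef1.
  by case: w => [|a w]; rewrite /= mulr0 add0r.
rewrite coefM_letter coefM_letterN // addr0 coef1.
by case: w => [|a w]; rewrite /= mulr0 add0r.
Qed.

Lemma rpart_decomp (X : ncs k) :
  X = (counit X)%:A + rpartA X * serA + rpartB X * serB.
Proof.
apply/fpsP => w; rewrite !coefD coefZ coef1.
case/lastP: w => [|w b]; first by rewrite !coefM_letter0 !addr0 mulr1.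
have -> : (rcons w b == 1%g :> word bool) = false by case: w.
rewrite mulr0 add0r; case: b.
  by rewrite coefM_letterN // coefM_letter add0r.
by rewrite coefM_letter coefM_letterN // addr0.
Qed.

Definition abA : fps k (prodm expo expo) := mono ((1%N, 0%N) : prodm expo expo).
Definition abB : fps k (prodm expo expo) := mono ((0%N, 1%N) : prodm expo expo).

Definition ab (X : ncs k) : fps k (prodm expo expo) := subst2 X abA abB.

End FreeAlgebra.

Arguments letter {k I} i.
Arguments serA {k}.
Arguments serB {k}.
Arguments abA {k}.
Arguments abB {k}.

(* The generators t_ij of t_n; strands are numbered from 0. The relation      *)
(* t_ij = t_ji is imposed among the relators below.                           *)
Definition tletter (n : nat) : finType := {p : 'I_n * 'I_n | p.1 != p.2}.

Section DrinfeldKohno.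
Variable k : fieldType.

(* extended by t_ii = 0 *)
Definition tgen n (i j : 'I_n) : fps k (word (tletter n)) :=
  if insub (i, j) is Some p then letter (p : tletter n) else 0.

Definition bracket (M : gradedMonoidType) (x y : fps k M) : fps k M :=
  x * y - y * x.

Inductive t_relator n : fps k (word (tletter n)) -> Prop :=
| t_relator_sym i j of i != j : t_relator (tgen i j - tgen j i)
| t_relator_3 i j l of uniq [:: i; j; l] :
    t_relator (bracket (tgen i j + tgen i l) (tgen j l))
| t_relator_4 i j l m of uniq [:: i; j; l; m] :
    t_relator (bracket (tgen i j) (tgen l m)).

(* The enveloping algebra of a Lie algebra given by generators and relations  *)
(* is the associative algebra with the same presentation: U(t_n) is the free  *)
(* associative algebra on the t_ij modulo the two-sided ideal generated by    *)
(* the relators of t_n. This is that ideal, spanned by the products           *)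
(* (word) * (relator) * (word).                                               *)
Inductive t_ideal n : fps k (word (tletter n)) -> Prop :=
| t_ideal_0 : t_ideal 0
| t_ideal_add (c : k) (u v : word (tletter n)) r f of
    t_relator r & t_ideal f : t_ideal (c *: (mono u * r * mono v) + f).

Definition homog n (d : nat) (f : fps k (word (tletter n))) :
    fps k (word (tletter n)) :=
  fun w => if deg w == d then f w else 0.

(* Equality in the degree completion of U(t_n), the product over d of the     *)
(* components U(t_n)_d, each one a quotient of the homogeneous noncommutative *)
(* polynomials of degree d.                                                   *)
Definition Ut_eq n (f g : fps k (word (tletter n))) : Prop :=
  forall d, t_ideal (homog d (f - g)).

(* x |-> x^{I_1, ..., I_n} *)
Definition insertion n m (I : 'I_n -> {set 'I_m})
    (x : fps k (word (tletter n))) : fps k (word (tletter m)) :=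
  fps_subst (fun p : tletter n =>
    \sum_(a in I (val p).1) \sum_(b in I (val p).2) tgen a b) x.

(* Here strands are numbered from 1, so that [:: [:: 1]; [:: 2; 3]; [:: 4]]   *)
(* stands for the superscript 1,23,4.                                         *)
Definition blocks n m (s : seq (seq nat)) (i : 'I_n) : {set 'I_m} :=
  [set a : 'I_m | a.+1 \in nth [::] s i].

(* A = t_12, B = t_23 *)
Definition to_t3 (X : ncs k) : fps k (word (tletter 3)) :=
  subst2 X (tgen (@Ordinal 3 0 isT) (@Ordinal 3 1 isT))
           (tgen (@Ordinal 3 1 isT) (@Ordinal 3 2 isT)).

Definition grouplike (Phi : ncs k) : Prop := coproduct Phi = tensor Phi Phi.

Definition hexagon (lambda : k) (Phi : ncs k) : Prop :=
  let serC := - serA - serB in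
  let e x := fps_exp ((lambda / 2%:R) *: x) in
  subst2 Phi serA serB * e serA * subst2 Phi serC serA * e serC
    * subst2 Phi serB serC * e serB = 1.

Definition pentagon (Phi : ncs k) : Prop :=
  let P s := insertion (blocks 4 s) (to_t3 Phi) in
  Ut_eq
    (P [:: [:: 2]; [:: 3]; [:: 4]] * P [:: [:: 1]; [:: 2; 3]; [:: 4]]
       * P [:: [:: 1]; [:: 2]; [:: 3]])
    (P [:: [:: 1]; [:: 2]; [:: 3; 4]] * P [:: [:: 1; 2]; [:: 3]; [:: 4]]).

(* Phi is an element of Assoc_lambda(k) *)
Definition Assoc (lambda : k) (Phi : ncs k) : Prop :=
  [/\ Phi \is a GRing.unit, grouplike Phi, hexagon lambda Phi & pentagon Phi].

(* exp (- sum_(n >= 2) zeta(n) u^n / n) *)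
Definition Gamma (zeta : nat -> k) : fps k expo :=
  fps_exp (fun n : expo => if (2 <= n)%N then - (zeta n / n%:R) else 0).

Definition Gamma_factorization (Phi : ncs k) (zeta : nat -> k) : Prop :=
  ab (1 + rpartB Phi * serB) =
    fps_eval (Gamma zeta) (abA + abB)
      / (fps_eval (Gamma zeta) abA * fps_eval (Gamma zeta) abB).

Lemma unit_Gamma zeta (M : gradedMonoidType) (x : fps k M) :
  fps_eval (Gamma zeta) x \is a GRing.unit.
Proof.
rewrite unit_fps fps_eval_const -[0%N]/(1%g : expo) -unit_fps.
exact: unit_fps_exp.
Qed.

End DrinfeldKohno.

(* (e^u - 1) / u *)
Definition expm1_div : fps rat expo := fun n : expo => (n.+1`!%:R)^-1.

Definition bernoulli (n : nat) : rat := n`!%:R * (expm1_div^-1) (n : expo).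

Lemma expr_mono1 (k : fieldType) (l n : nat) :
  ((mono (1%N : expo) : fps k expo) ^+ l) (n : expo) = (n == l)%:R.
Proof.
elim: l n => [|l IH] n; first by rewrite expr0 coef1.
rewrite exprSr; case: n => [|n].
  by rewrite coefM_mono0 // => a; rewrite [(a * _)%g]addn1.
rewrite (@coefM_mono _ _ _ _ (n : expo)) ?IH ?eqSS //; first exact: addn1.
by move=> a; rewrite [(a * _)%g]addn1 => -[].
Qed.

(* u / (e^u - 1) = sum_k B_k u^k / k! *)
Lemma bernoulli_genfun :
  ((fun n : expo => bernoulli n / n`!%:R) : fps rat expo)
    * (fps_exp (mono (1%N : expo)) - 1) = mono (1%N : expo).
Proof.
have -> : ((fun n : expo => bernoulli n / n`!%:R) : fps rat expo) = expm1_div^-1.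
  apply/fpsP => n; rewrite /bernoulli mulrAC mulfV ?mul1r //.
  by rewrite Num.Theory.pnatr_eq0 -lt0n fact_gt0.
have -> : fps_exp (mono (1%N : expo)) - 1 = expm1_div * mono (1%N : expo).
  apply/fpsP => n; rewrite coefD coefN coef1 /fps_exp /fps_eval.
  under eq_bigr do rewrite expr_mono1.
  rewrite (bigD1 ord_max) //= eqxx mulr1 big1 ?addr0; last first.
    by move=> i ne; rewrite (_ : (_ == _) = false) ?mulr0 //; apply/negbTE; rewrite eq_sym.
  case: n => [|n]; first by rewrite coefM_mono0 ?fact0 ?invr1 ?subrr // => a; rewrite [(_ * _)%g]addn1.
  rewrite subr0 (@coefM_mono _ _ _ _ (n : expo)) //; first exact: addn1.
  by move=> a; rewrite [(a * _)%g]addn1 => -[].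
by rewrite mulrA mulVr ?mul1r // unit_fps /expm1_div invr1.
Qed.

(* r_n = - B_n / (2 n!) *)
Definition rnum (n : nat) : rat := - bernoulli n / (2%:R * n`!%:R).

(* Main.v *)
Require Import Defs.
From HB Require Import structures.
From mathcomp Require Import all_boot all_order all_algebra.
From mathcomp Require Import boolp ring.

(* Specialise everything to power series in one variable h: a representation  *)
(* of t_4 (or of the free algebra) by matrices over k turns the series into   *)
(* matrices over k[[h]], and F(p, q) := (1 + Phi_B B)^ab(hp, hq) into an      *)
(* element of k[[h]] for scalars p and q.                                     *)
(*   The pentagon, in the infinitesimal Gassner representation of t_4 with    *)
(* weights (0, x, y, z), says that the 2 x 2 matrix of Phi(t_23, t_34) sends  *)
(* an explicit vector to another one, both built from values of F. The same   *)
(* relation for the weights (0, z, y, x), the duality                         *)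
(* Phi(A, B) Phi(B, A) = 1 and the fact that this matrix has determinant 1    *)
(* eliminate the matrix and leave                                             *)
(*   F(r, q) F(p, q + r) = F(p, q) F(r, p + q).                               *)
(* As F is symmetric this is the 2-cocycle identity. Its part linear in r is  *)
(* the differential equation satisfied by G(p + q) / (G(p) G(q)), G = Gamma,  *)
(* with zeta(n) minus the coefficient of a b^(n - 1) in F.                    *)
(*   In a representation by affine maps of the line with A, B, C acting with  *)
(* slopes 1, 1, -2, the hexagon becomes                                       *)
(*   2 F(1, 1) = e^(- lambda h / 2) F(1, -2) + e^(lambda h / 2) F(-2, 1),     *)
(* that is P(2 h) = cosh(lambda h / 2) P(h) for P(h) = G(h) G(- h), whence    *)
(* P(h) = 2 sinh(lambda h / 2) / (lambda h), and the even zeta(n).            *)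

Set Implicit Arguments.
Unset Strict Implicit.
Unset Printing Implicit Defensive.

Import GRing.Theory.
Local Open Scope ring_scope.

(** A series in two commuting variables is determined by its values at (p h, h) for almost all
    scalars p ([spec_inj]), so the factorization can be tested on [Fh], the F above. Phi_B enters
    through [hev2_Phi_column]: if u is an eigenvector of A and B u is a multiple of a common
    eigenvector e of A and B, then Phi moves u by a multiple of (F - 1) e. Combined with the
    pentagon in a representation ([pentagon_hev2]), with Phi^ab = 1 ([sev_grouplike]), with duality
    ([hev2_dual]) and with [det_hev2], this gives the cocycle relation [Fh_cocycle] and the symmetry
    [Fh_sym].

    In characteristic 0 a symmetric cocycle is a coboundary: differentiating at r = 0 ([Fh_partial],
    [theta_Fh]) shows that F(p, q) G(p) G(q) and G(p + q) solve the same first-order equation with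
    the same constant term ([Fh_Gser]). Uniqueness comes from the logarithmic derivative of F(1, 1),
    in which zeta(n) has the coefficient 2 - 2^n.

    The hexagon ([hexagon_Fh]) then becomes a functional equation for P(h) = G(h) G(- h), solved in
    [reflection_sinh]. The odd zeta(n) cancel in P; the even ones are read off its logarithmic
    derivative, where the Bernoulli series appears ([zeta_even]). *)

HB.mixin Record GradedMonoid_isLocallyFinite M of GradedMonoid M := {
  mons : nat -> seq M;
  mons_uniq : forall d, uniq (mons d);
  mem_mons : forall d (m : M), (m \in mons d) = (deg m == d)
}.

#[short(type="lfMonoidType")]
HB.structure Definition LFMonoid := {M of GradedMonoid_isLocallyFinite M & GradedMonoid M}.

(** * Finitely many monomials in each degree *)

Section WordLF.
Variable I : finType.

Definition word_mons (d : nat) : seq (word I) := [seq val w | w : d.-tuple I].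

Fact word_mons_uniq d : uniq (word_mons d).
Proof. by rewrite map_inj_uniq ?enum_uniq //; apply: val_inj. Qed.

Fact mem_word_mons d (m : word I) : (m \in word_mons d) = (deg m == d).
Proof.
apply/mapP/idP => [[w _ ->]|hm]; first by rewrite /deg /= size_tuple.
by exists (Tuple hm); rewrite ?mem_enum.
Qed.

HB.instance Definition _ :=
  GradedMonoid_isLocallyFinite.Build (word I) word_mons_uniq mem_word_mons.
End WordLF.

Section ExpoLF.
Fact expo_mons_uniq (d : nat) : uniq [:: (d : expo)]. Proof. by []. Qed.
Fact mem_expo_mons (d : nat) (m : expo) : (m \in [:: (d : expo)]) = (deg m == d).
Proof. by rewrite inE. Qed.
HB.instance Definition _ :=
  GradedMonoid_isLocallyFinite.Build expo expo_mons_uniq mem_expo_mons.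
End ExpoLF.

Section ProdLF.
Variables M N : lfMonoidType.

Definition prodm_mons (d : nat) : seq (prodm M N) :=
  [seq p | i <- iota 0 d.+1,
           p <- [seq ((u, v) : prodm M N) | u <- mons i, v <- mons (d - i)%N]].

Lemma prodm_degE (m : prodm M N) : deg m = (deg m.1 + deg m.2)%N.
Proof. by []. Qed.

Fact mem_prodm_mons d (m : prodm M N) : (m \in prodm_mons d) = (deg m == d).
Proof.
apply/allpairsPdep/eqP => [[i [p []]]|<-].
  rewrite mem_iota add0n ltnS => /= hi /allpairsP[[u v] /= []].
  rewrite !mem_mons => /eqP hu /eqP hv -> ->.
  by rewrite prodm_degE /= hu hv subnKC.
exists (deg m.1), m; split=> //.
  by rewrite mem_iota add0n ltnS prodm_degE leq_addr.
apply/allpairsP; exists (m.1, m.2); rewrite !mem_mons /=.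
by split=> //; [rewrite prodm_degE addKn|case: m].
Qed.

Fact prodm_mons_uniq d : uniq (prodm_mons d).
Proof.
apply: allpairs_uniq_dep => [|i _|]; first exact: iota_uniq.
  by apply: allpairs_uniq; rewrite ?mons_uniq // => -[a b] [a' b'] _ _ /= [-> ->].
move=> p q /allpairsPdep[i [u [hi hu ->]]] /allpairsPdep[j [v [hj hv ->]]] /= e.
subst v; have hd w l : w \in [seq ((u, v) : prodm M N) | u <- mons l, v <- mons (d - l)%N] ->
    deg w.1 = l.
  by case/allpairsP => -[a b] /= []; rewrite mem_mons => /eqP <- _ ->.
by rewrite -(hd _ _ hu) (hd _ _ hv).
Qed.

HB.instance Definition _ :=
  GradedMonoid_isLocallyFinite.Build (prodm M N) prodm_mons_uniq mem_prodm_mons.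
End ProdLF.

Lemma big_prodm_mons (M N : lfMonoidType) (V : nmodType) (G : prodm M N -> V) d :
  \sum_(m <- mons d) G m =
  \sum_(i < d.+1) \sum_(u <- mons i) \sum_(v <- mons (d - i)) G (u, v).
Proof.
rewrite -(big_mkord xpredT (fun i => \sum_(u <- mons i) \sum_(v <- mons (d - i)) G (u, v))).
rewrite big_allpairs_dep; apply: eq_bigr => i _.
by rewrite big_allpairs_dep.
Qed.

Section FactsSum.
Variables (k : fieldType) (M : lfMonoidType).

(** Both sides run over the pairs of monomials of total degree d, grouped by their product or by the
    degree of the first. This is what makes [hev] multiplicative. *)
Lemma big_mons_facts (V : nmodType) (G : M -> M -> V) d :
  \sum_(m <- mons d) \sum_(p <- facts m) G p.1 p.2 =
  \sum_(i < d.+1) \sum_(u <- mons i) \sum_(v <- mons (d - i)) G u v :> V.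
Proof.
transitivity (\sum_(p <- [seq p | m <- mons d, p <- @facts M m]) G p.1 p.2).
  by rewrite big_allpairs_dep.
transitivity (\sum_(p <- (mons d : seq (prodm M M))) G p.1 p.2); last first.
  exact: (@big_prodm_mons M M _ (fun p => G p.1 p.2)).
apply/perm_big/uniq_perm; last 1 first.
- move=> p; rewrite [RHS]mem_prodm_mons prodm_degE; apply/allpairsPdep/eqP.
    case=> m [q []]; rewrite mem_mons mem_facts => /eqP hm /eqP e ->.
    by rewrite -degM e.
  move=> h; exists (p.1 * p.2)%g, p.
  by rewrite mem_mons mem_facts degM h !eqxx.
- apply: allpairs_uniq_dep => [|m _|]; [exact: mons_uniq|exact: facts_uniq|].
  move=> p q /allpairsPdep[m [u [_ hu ->]]] /allpairsPdep[n [v [_ hv ->]]] /= e.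
  by subst v; move: hu hv; rewrite !mem_facts => /eqP <- /eqP <-.
- exact: prodm_mons_uniq.
Qed.
End FactsSum.

(** * The commutative ring k[[h]] *)

Definition ps (k : fieldType) : Type := fps k expo.

Section PowerSeries.
Variable k : fieldType.
HB.instance Definition _ := GRing.UnitRing.on (ps k).
HB.instance Definition _ := GRing.Algebra.on (ps k).

Implicit Types f g : ps k.

Lemma psP f g : (forall d : nat, f d = g d) -> f = g.
Proof. by move=> h; apply/fpsP. Qed.

Lemma psM f g (d : nat) : (f * g) d = \sum_(i < d.+1) f (i : nat) * g (d - i)%N.
Proof.
rewrite (@Defs.coefM k expo f g d : (f * g) d = _) /facts /= /expo_facts big_map.
by rewrite -{1}[d.+1]subn0 -/(index_iota 0 d.+1) big_mkord.
Qed.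

Fact ps_mulC : commutative (@GRing.mul (ps k)).
Proof.
move=> f g; apply: psP => d; rewrite !psM (reindex_inj rev_ord_inj) /=.
apply: eq_bigr => i _; rewrite subSS subKn; last exact: leq_ord.
exact: mulrC.
Qed.
HB.instance Definition _ := GRing.PzRing_hasCommutativeMul.Build (ps k) ps_mulC.

Lemma psD f g (d : nat) : (f + g) d = f d + g d. Proof. by []. Qed.
Lemma psN f (d : nat) : (- f) d = - f d. Proof. by []. Qed.
Lemma psZ (c : k) f (d : nat) : (c *: f) d = c * f d. Proof. by []. Qed.
Lemma ps0 (d : nat) : (0 : ps k) d = 0. Proof. by []. Qed.
Lemma ps1 (d : nat) : (1 : ps k) d = (d == 0%N)%:R. Proof. exact: Defs.coef1. Qed.
Lemma ps_const (c : k) (d : nat) : (c%:A : ps k) d = c * (d == 0%N)%:R.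
Proof. by rewrite psZ ps1. Qed.
Lemma ps_sum (J : Type) (r : seq J) (P : pred J) (F : J -> ps k) (d : nat) :
  (\sum_(j <- r | P j) F j) d = \sum_(j <- r | P j) F j d.
Proof. exact: Defs.coef_sum. Qed.

Definition hX : ps k := mono (1%N : expo).

Lemma psXM f (d : nat) : (hX * f) d = if d is d'.+1 then f d' else 0.
Proof.
rewrite mulrC; case: d => [|d].
  by apply: coefM_mono0 => a; rewrite [(_ * _)%g]addn1.
by apply: coefM_mono => [|a]; rewrite [(_ * _)%g]addn1 // => -[].
Qed.

End PowerSeries.

Arguments hX {k}.

(** * Evaluation of series at matrices *)

Notation cmx := (map_mx (in_alg (ps _))).

Section Evaluation.
Variables (k : fieldType) (M : lfMonoidType).
Implicit Types f g : fps k M.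

Definition mrep n (rho : M -> 'M[k]_n) : Prop :=
  rho 1%g = 1%:M /\ forall u v, rho (u * v)%g = rho u *m rho v.

Definition lev n (rho : M -> 'M[k]_n) (d : nat) f : 'M[k]_n :=
  \sum_(m <- mons d) f m *: rho m.

(** Each monomial m is weighted by h^(deg m), so that the sum over all monomials makes sense for
    every [rho], nilpotent or not. *)
Definition hev n (rho : M -> 'M[k]_n) f : 'M[ps k]_n :=
  \matrix_(i, j) (fun d : expo => lev rho d f i j).

Lemma hevE n (rho : M -> 'M[k]_n) f i j (d : nat) :
  hev rho f i j d = lev rho d f i j.
Proof. by rewrite mxE. Qed.

Lemma levD n (rho : M -> 'M[k]_n) d f g :
  lev rho d (f + g) = lev rho d f + lev rho d g.
Proof. by rewrite /lev -big_split /=; apply: eq_bigr => m _; rewrite -scalerDl. Qed.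

Lemma levZ n (rho : M -> 'M[k]_n) d c f : lev rho d (c *: f) = c *: lev rho d f.
Proof. by rewrite /lev scaler_sumr; apply: eq_bigr => m _; rewrite scalerA. Qed.

Lemma lev0 n (rho : M -> 'M[k]_n) d : lev rho d 0 = 0.
Proof. by rewrite -[0 in LHS](scale0r 0) levZ scale0r. Qed.

Lemma levN n (rho : M -> 'M[k]_n) d f : lev rho d (- f) = - lev rho d f.
Proof. by rewrite -scaleN1r levZ scaleN1r. Qed.

Lemma lev_sum n (rho : M -> 'M[k]_n) d (J : Type) (r : seq J) (P : pred J) F :
  lev rho d (\sum_(j <- r | P j) F j) = \sum_(j <- r | P j) lev rho d (F j).
Proof.
by apply: (big_morph (lev rho d)); [exact: levD|exact: lev0].
Qed.

Lemma lev_mono n (rho : M -> 'M[k]_n) d m :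
  lev rho d (mono m) = if d == deg m then rho m else 0.
Proof.
rewrite /lev /mono; have [->|ne] := eqVneq d (deg m).
  rewrite (bigD1_seq m) ?mons_uniq ?mem_mons //= eqxx scale1r big1 ?addr0 //.
  by move=> m' /negPf ->; rewrite scale0r.
rewrite big1_seq // => m'; rewrite mem_mons /= => /eqP e.
by case: eqP => [e'|_]; rewrite ?scale0r //; rewrite -e -e' eqxx in ne.
Qed.

Lemma lev1 n (rho : M -> 'M[k]_n) d : mrep rho ->
  lev rho d 1 = if d == 0%N then 1%:M else 0.
Proof. by case=> r1 _; rewrite -[1 in LHS]/(mono 1%g) lev_mono deg1 r1. Qed.

Lemma levM n (rho : M -> 'M[k]_n) d f g : mrep rho ->
  lev rho d (f * g) = \sum_(i < d.+1) lev rho i f *m lev rho (d - i) g.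
Proof.
case=> _ rM; rewrite /lev.
transitivity (\sum_(m <- mons d) \sum_(p <- facts m)
    (f p.1 * g p.2) *: (rho p.1 *m rho p.2)).
  apply: eq_bigr => m _; rewrite Defs.coefM scaler_suml.
  by apply: eq_big_seq => p; rewrite mem_facts => /eqP <-; rewrite rM.
rewrite (big_mons_facts (fun u v => (f u * g v) *: (rho u *m rho v))).
apply: eq_bigr => i _; rewrite mulmx_suml; apply: eq_bigr => u _.
rewrite mulmx_sumr; apply: eq_bigr => v _.
by rewrite -scalemxAl -scalemxAr scalerA.
Qed.

Lemma hevP n (rho : M -> 'M[k]_n) f g :
  (forall d, lev rho d f = lev rho d g) -> hev rho f = hev rho g.
Proof. by move=> h; apply/matrixP => i j; apply: psP => d; rewrite !hevE h. Qed.

Lemma hevD n (rho : M -> 'M[k]_n) f g : hev rho (f + g) = hev rho f + hev rho g.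
Proof. by apply/matrixP => i j; apply: psP => d; rewrite hevE levD !mxE psD. Qed.

Lemma hevN n (rho : M -> 'M[k]_n) f : hev rho (- f) = - hev rho f.
Proof. by apply/matrixP => i j; apply: psP => d; rewrite hevE levN !mxE psN. Qed.

Lemma hevZ n (rho : M -> 'M[k]_n) c f : hev rho (c *: f) = c%:A *: hev rho f.
Proof.
by apply/matrixP => i j; apply: psP => d;
   rewrite hevE levZ !mxE -scalerAl mul1r psZ.
Qed.

Lemma hev1 n (rho : M -> 'M[k]_n) : mrep rho -> hev rho 1 = 1%:M.
Proof.
move=> hr; apply/matrixP => i j; apply: psP => d; rewrite hevE lev1 // mxE.
have -> : ((i == j)%:R : ps k) d = (d == 0%N)%:R * (i == j)%:R.
  by case: (i == j); rewrite ?ps1 ?mulr1 // mulr0.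
by case: (d == 0%N); rewrite mxE ?mul1r ?mul0r.
Qed.

Lemma hevM n (rho : M -> 'M[k]_n) f g : mrep rho ->
  hev rho (f * g) = hev rho f *m hev rho g.
Proof.
move=> hr; apply/matrixP => i j; apply: psP => d.
rewrite hevE levM // summxE mxE ps_sum.
under [RHS]eq_bigr do rewrite psM.
rewrite exchange_big /=; apply: eq_bigr => l _; rewrite mxE.
by apply: eq_bigr => a _; rewrite !hevE.
Qed.

Lemma mulmx_cmx m n p (A : 'M[ps k]_(m, n)) (B : 'M[k]_(n, p)) i j (d : nat) :
  (A *m cmx B) i j d = \sum_l A i l d * B l j.
Proof.
rewrite mxE ps_sum; apply: eq_bigr => l _.
by rewrite mxE /= -scalerAr mulr1 psZ mulrC.
Qed.

Lemma cmx_mulmx m n p (B : 'M[k]_(m, n)) (A : 'M[ps k]_(n, p)) i j (d : nat) :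
  (cmx B *m A) i j d = \sum_l B i l * A l j d.
Proof.
rewrite mxE ps_sum; apply: eq_bigr => l _.
by rewrite mxE /= -scalerAl mul1r psZ.
Qed.

(** With J a column this treats common eigenvectors, with J injective invariant subspaces, with J a
    row quotients of dimension 1. *)
Lemma hev_intertwine m n (rho : M -> 'M[k]_m) (rho' : M -> 'M[k]_n)
    (J : 'M[k]_(m, n)) f :
  (forall w, rho w *m J = J *m rho' w) -> hev rho f *m cmx J = cmx J *m hev rho' f.
Proof.
move=> h; apply/matrixP => i j; apply: psP => d; rewrite mulmx_cmx cmx_mulmx.
have /matrixP/(_ i j) : lev rho d f *m J = J *m lev rho' d f.
  rewrite /lev mulmx_suml mulmx_sumr; apply: eq_bigr => w _.
  by rewrite -scalemxAl -scalemxAr h.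
rewrite !mxE => e; transitivity (\sum_l lev rho d f i l * J l j).
  by apply: eq_bigr => l _; rewrite hevE.
by rewrite e; apply: eq_bigr => l _; rewrite hevE.
Qed.

(** Substituting elements of degree 1 respects the grading, so it commutes with the evaluation
    degree by degree. *)
Definition hom1 f : Prop := forall m, deg m != 1%N -> f m = 0.

Lemma lev_hom1 n (rho : M -> 'M[k]_n) d f : hom1 f -> d != 1%N -> lev rho d f = 0.
Proof.
move=> hf hd; rewrite /lev big1_seq // => m; rewrite mem_mons => /eqP e.
by rewrite hf ?scale0r // e.
Qed.

Lemma lev_hom1M n (rho : M -> 'M[k]_n) d f g : mrep rho -> hom1 f ->
  lev rho d (f * g) = if d is d'.+1 then lev rho 1 f *m lev rho d' g else 0.
Proof.
move=> hr hf; rewrite levM //; case: d => [|d].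
  by rewrite big_ord1 lev_hom1 ?mul0mx.
rewrite big_ord_recl lev_hom1 // mul0mx add0r big_ord_recl /= [X in _ + X]big1.
  by rewrite addr0 subSS subn0.
by move=> i _; rewrite lev_hom1 ?mul0mx.
Qed.

Lemma lev_prod_hom1 n (rho : M -> 'M[k]_n) (I : Type) (x : I -> fps k M) d s :
  mrep rho -> (forall i, hom1 (x i)) ->
  lev rho d (\prod_(i <- s) x i) =
    if d == size s then \prod_(i <- s) lev rho 1 (x i) else 0.
Proof.
move=> hr hx; elim: s d => [|i s IH] d; first by rewrite !big_nil lev1.
rewrite !big_cons lev_hom1M //; case: d => [|d] //=.
by rewrite IH eqSS; case: (d == _) => //; rewrite mulmx0.
Qed.

Lemma lev_hom1X n (rho : M -> 'M[k]_n) (x : fps k M) d l : mrep rho -> hom1 x ->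
  lev rho d (x ^+ l) = if d == l then lev rho 1 x ^+ l else 0.
Proof.
move=> hr hx; elim: l d => [|l IH] d; first by rewrite !expr0 lev1.
rewrite !exprS lev_hom1M //; case: d => [|d] //=.
by rewrite IH // eqSS; case: (d == _) => //; rewrite mulmx0.
Qed.

End Evaluation.

Definition wrep (k : fieldType) (I : finType) n (r : I -> 'M[k]_n) (w : word I) :
  'M[k]_n := \prod_(i <- w) r i.

Lemma wrep_mrep (k : fieldType) (I : finType) n (r : I -> 'M[k]_n) : mrep (wrep r).
Proof. by split=> [|u v]; rewrite /wrep ?big_nil // big_cat. Qed.

Section Substitution.
Variables (k : fieldType) (M : lfMonoidType) (n : nat) (rho : M -> 'M[k]_n).
Hypothesis hrho : mrep rho.

Lemma lev_fps_subst (I : finType) (x : I -> fps k M) (S : fps k (word I)) d :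
  (forall i, hom1 (x i)) ->
  lev rho d (fps_subst x S) = lev (wrep (fun i => lev rho 1 (x i))) d S.
Proof.
move=> hx.
transitivity (lev rho d (\sum_(l < d.+1) \sum_(w : l.-tuple I)
    S (w : seq I) *: \prod_(i <- w) x i)).
  apply: eq_big_seq => m; rewrite mem_mons => /eqP e; congr (_ *: _).
  rewrite /fps_subst e Defs.coef_sum; apply: eq_bigr => l _.
  by rewrite Defs.coef_sum.
(* A product of l elements of degree 1 has degree l, so only the words of length d reach level d. *)
rewrite lev_sum (bigD1 ord_max) //= [X in _ + X]big1 ?addr0; last first.
  move=> l ne; rewrite lev_sum big1 // => w _.
  rewrite levZ lev_prod_hom1 // size_tuple ifN ?scaler0 //.
  by apply: contra_neq ne => e; apply: val_inj.
rewrite lev_sum /lev {2}/mons /= /word_mons big_map big_enum /=.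
apply: eq_bigr => w _; rewrite -/(lev _ _ _) levZ lev_prod_hom1 //.
by rewrite size_tuple eqxx.
Qed.

Lemma hev_fps_subst (I : finType) (x : I -> fps k M) (S : fps k (word I)) :
  (forall i, hom1 (x i)) ->
  hev rho (fps_subst x S) = hev (wrep (fun i => lev rho 1 (x i))) S.
Proof.
by move=> hx; apply/matrixP => i j; apply: psP => d; rewrite !hevE lev_fps_subst.
Qed.

Lemma lev_fps_eval (c : fps k expo) (x : fps k M) d : hom1 x ->
  lev rho d (fps_eval c x) = c d *: lev rho 1 x ^+ d.
Proof.
move=> hx.
transitivity (lev rho d (\sum_(l < d.+1) c (l : nat) *: x ^+ l)).
  apply: eq_big_seq => m; rewrite mem_mons => /eqP e; congr (_ *: _).
  by rewrite /fps_eval e Defs.coef_sum.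
rewrite lev_sum (bigD1 ord_max) //= [X in _ + X]big1 ?addr0; last first.
  move=> l ne; rewrite levZ lev_hom1X // ifN ?scaler0 //.
  by apply: contra_neq ne => e; apply: val_inj.
by rewrite levZ lev_hom1X // eqxx.
Qed.

End Substitution.

Section Homogeneous.
Variables (k : fieldType) (M : lfMonoidType).
Implicit Types f g : fps k M.

Lemma hom1_mono (m : M) : deg m = 1%N -> hom1 (mono m : fps k M).
Proof. by move=> hm m' ne; rewrite /mono; case: eqP => // e; rewrite e hm in ne. Qed.

Lemma hom1_0 : hom1 (0 : fps k M). Proof. by []. Qed.

Lemma hom1D f g : hom1 f -> hom1 g -> hom1 (f + g).
Proof. by move=> hf hg m hm; rewrite Defs.coefD hf ?hg ?addr0. Qed.

Lemma hom1N f : hom1 f -> hom1 (- f).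
Proof. by move=> hf m hm; rewrite Defs.coefN hf ?oppr0. Qed.

Lemma hom1Z c f : hom1 f -> hom1 (c *: f).
Proof. by move=> hf m hm; rewrite Defs.coefZ hf ?mulr0. Qed.

Lemma hom1_sum (J : finType) (P : pred J) (F : J -> fps k M) :
  (forall j, hom1 (F j)) -> hom1 (\sum_(j | P j) F j).
Proof. by move=> hF m hm; rewrite Defs.coef_sum big1 // => j _; apply: hF. Qed.
End Homogeneous.

Section Words.
Variables (k : fieldType) (I : finType).

Lemma wrep1 n (r : I -> 'M[k]_n) i : wrep r [:: i] = r i.
Proof. by rewrite /wrep big_seq1. Qed.

Lemma wrep_eq n (r r' : I -> 'M[k]_n) : r =1 r' -> wrep r =1 wrep r'.
Proof. by move=> h w; apply: eq_bigr => i _. Qed.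

Lemma hev_eq n (rho rho' : word I -> 'M[k]_n) f : rho =1 rho' -> hev rho f = hev rho' f.
Proof. by move=> /funext ->. Qed.

Lemma hom1_letter (i : I) : hom1 (letter i : fps k (word I)).
Proof. exact: hom1_mono. Qed.

Lemma lev_letter n (r : I -> 'M[k]_n) i : lev (wrep r) 1 (letter i) = r i.
Proof. by rewrite lev_mono wrep1. Qed.

Lemma hev_letter n (r : I -> 'M[k]_n) i : hev (wrep r) (letter i) = hX *: cmx (r i).
Proof.
apply/matrixP => a b; apply: psP => d; rewrite hevE lev_mono wrep1 !mxE /= psXM.
case: d => [|[|d]]; rewrite ?mxE //= ps_const ?mulr1 ?mulr0 //.
Qed.

Lemma whev_intertwine m n (r : I -> 'M[k]_m) (r' : I -> 'M[k]_n) (J : 'M[k]_(m, n)) f :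
  (forall i, r i *m J = J *m r' i) ->
  hev (wrep r) f *m cmx J = cmx J *m hev (wrep r') f.
Proof.
move=> h; apply: hev_intertwine => w; rewrite /wrep.
elim: w => [|i w IH]; first by rewrite !big_nil mul1mx mulmx1.
by rewrite !big_cons -!mulmxE -mulmxA IH mulmxA h mulmxA.
Qed.
End Words.

(** * Evaluation of series in A and B at two matrices *)

Section TwoLetters.
Variable k : fieldType.
Implicit Types (X Y : ncs k) (p q : k).

Definition pairrep n (A B : 'M[k]_n) (b : bool) : 'M[k]_n := if b then B else A.

Definition hev2 n (A B : 'M[k]_n) X : 'M[ps k]_n := hev (wrep (pairrep A B)) X.

(** This is X^ab at (p h, q h); see [spec_ab]. *)
Definition sev p q X : ps k := hev2 (p%:M : 'M_1) q%:M X 0 0.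

Lemma hev2_1 p q X : hev2 (p%:M : 'M_1) q%:M X = (sev p q X)%:M.
Proof. by rewrite [LHS]mx11_scalar. Qed.

Lemma hev2M n (A B : 'M[k]_n) X Y : hev2 A B (X * Y) = hev2 A B X *m hev2 A B Y.
Proof. exact/hevM/wrep_mrep. Qed.

Lemma hev2D n (A B : 'M[k]_n) X Y : hev2 A B (X + Y) = hev2 A B X + hev2 A B Y.
Proof. exact: hevD. Qed.

Lemma hev2_one n (A B : 'M[k]_n) : hev2 A B 1 = 1%:M.
Proof. exact/hev1/wrep_mrep. Qed.

Lemma sevM p q X Y : sev p q (X * Y) = sev p q X * sev p q Y.
Proof. by rewrite /sev hev2M mxE big_ord1. Qed.

Lemma sevD p q X Y : sev p q (X + Y) = sev p q X + sev p q Y.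
Proof. by rewrite /sev hev2D mxE. Qed.

Lemma sev1 p q : sev p q 1 = 1.
Proof. by rewrite /sev hev2_one mxE eqxx. Qed.

Lemma hev2_intertwine m n (A B : 'M[k]_m) (A' B' : 'M[k]_n) (J : 'M[k]_(m, n)) X :
  A *m J = J *m A' -> B *m J = J *m B' ->
  hev2 A B X *m cmx J = cmx J *m hev2 A' B' X.
Proof. by move=> hA hB; apply: whev_intertwine => -[]. Qed.

Lemma hev2_eigen n (A B : 'M[k]_n) (e : 'cV[k]_n) p q X :
  A *m e = p *: e -> B *m e = q *: e ->
  hev2 A B X *m cmx e = sev p q X *: cmx e.
Proof.
move=> hA hB; rewrite -mul_mx_scalar -hev2_1; apply: hev2_intertwine.
- by rewrite mul_mx_scalar.
- by rewrite mul_mx_scalar.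
Qed.

Lemma hev2_serA n (A B : 'M[k]_n) : hev2 A B serA = hX *: cmx A.
Proof. exact: hev_letter. Qed.

Lemma hev2_serB n (A B : 'M[k]_n) : hev2 A B serB = hX *: cmx B.
Proof. exact: hev_letter. Qed.

Lemma sev_serB p q : sev p q serB = hX * q%:A.
Proof. by rewrite /sev hev2_serB !mxE eqxx. Qed.

(** Write X = counit(X) + X_A A + X_B B. The middle term kills u, and the last one sends u to a
    multiple of X_B e, where X_B acts by a scalar. The factor q turns the value of X_B into that of
    X_B B. *)
Lemma hev2_column n (A B : 'M[k]_n) (u e : 'cV[k]_n) p q s X :
  A *m u = 0 -> B *m u = s *: e -> A *m e = p *: e -> B *m e = q *: e ->
  q%:A *: (hev2 A B X *m cmx u) =
    (q * counit X)%:A *: cmx u + (s%:A * sev p q (rpartB X * serB)) *: cmx e.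
Proof.
move=> Au Bu Ae Be.
rewrite [X in hev2 A B X]rpart_decomp !hev2D !hev2M hev2_serA hev2_serB !mulmxDl.
rewrite -!mulmxA -!scalemxAl -!map_mxM Au Bu map_mx0 scaler0 mulmx0 addr0.
rewrite /hev2 hevZ -/(hev2 A B 1) hev2_one -scalemxAl mul1mx.
rewrite map_mxZ /= -!scalemxAr (hev2_eigen _ Ae Be) sevM sev_serB.
rewrite scalerDr !scalerA; congr (_ *: _ + _ *: _).
  by rewrite -scalerAl mul1r scalerA.
ring.
Qed.

Lemma hev2_scalar n p q X : hev2 (p%:M : 'M_n) q%:M X = (sev p q X)%:M.
Proof.
apply/matrixP => i j.
have := @hev2_eigen n p%:M q%:M (delta_mx j 0) p q X.
rewrite !mul_scalar_mx => /(_ erefl erefl)/matrixP/(_ i 0).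
rewrite mxE (bigD1 j) //= big1 ?addr0; last first.
  by move=> l /negPf ne; rewrite [map_mx _ _ _ _]mxE [delta_mx _ _ _ _]mxE ne rmorph0 mulr0.
rewrite [map_mx _ _ _ _]mxE [delta_mx _ _ _ _]mxE !eqxx rmorph1 mulr1 => ->.
by rewrite !mxE andbT; case: (i == j); rewrite ?rmorph1 ?rmorph0 ?mulr1 ?mulr0.
Qed.
End TwoLetters.

(** * Group-like series and the pentagon *)

Section GroupLike.
Variable k : fieldType.
Implicit Types X Y : ncs k.

Lemma tensor_mono (a b : word bool) :
  tensor (mono a : ncs k) (mono b) = mono ((a, b) : prodm (word bool) (word bool)).
Proof.
apply/fpsP => -[u v]; rewrite /tensor /mono /=.
rewrite [(u, v) == _]/(((u == a) && (v == b))).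
by case: (u == a); case: (v == b); rewrite ?mul0r ?mulr0 ?mulr1.
Qed.

Lemma hev_tensor n (rho rho' : word bool -> 'M[k]_n) X Y :
  hev (fun m : prodm (word bool) (word bool) => rho m.1 *m rho' m.2) (tensor X Y) =
  hev rho X *m hev rho' Y.
Proof.
apply/matrixP => i j; apply: psP => d.
rewrite hevE mxE ps_sum; under eq_bigr do rewrite psM.
rewrite exchange_big /= {1}/lev big_prodm_mons summxE; apply: eq_bigr => l _.
rewrite /tensor /=.
have -> : \sum_(u <- mons l) \sum_(v <- mons (d - l)%N)
    X u * Y v *: (rho u *m rho' v) = lev rho l X *m lev rho' (d - l) Y.
  rewrite /lev mulmx_suml; apply: eq_bigr => u _.
  rewrite mulmx_sumr; apply: eq_bigr => v _.
  by rewrite -scalemxAl -scalemxAr scalerA.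
by rewrite mxE; apply: eq_bigr => a _; rewrite !hevE.
Qed.

(* The coproduct is dual to the sum of two commuting representations. *)
Lemma grouplike_hev2D n (A B A' B' : 'M[k]_n) X :
  grouplike X -> A *m A' = A' *m A -> A *m B' = B' *m A ->
  B *m A' = A' *m B -> B *m B' = B' *m B ->
  hev2 (A + A') (B + B') X = hev2 A B X *m hev2 A' B' X.
Proof.
move=> gX cAA cAB cBA cBB.
pose r := wrep (pairrep A B); pose r' := wrep (pairrep A' B').
have cr b b' : pairrep A B b *m pairrep A' B' b' = pairrep A' B' b' *m pairrep A B b.
  by case: b; case: b'.
have cw b v : pairrep A B b *m r' v = r' v *m pairrep A B b.
  rewrite /r' /wrep; elim: v => [|b' v IH]; first by rewrite !big_nil mulmx1 mul1mx.
  by rewrite !big_cons -mulmxE mulmxA cr -!mulmxA IH.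
have cww u v : r u *m r' v = r' v *m r u.
  rewrite /r /wrep; elim: u => [|b u IH]; first by rewrite !big_nil mulmx1 mul1mx.
  by rewrite !big_cons -mulmxE -mulmxA IH mulmxA cw -mulmxA.
have [r1 rM] := wrep_mrep (pairrep A B); have [r'1 r'M] := wrep_mrep (pairrep A' B').
pose tau (m : prodm (word bool) (word bool)) := r m.1 *m r' m.2.
have htau : mrep tau.
  split=> [|u v]; first by rewrite /tau [r _]r1 [r' _]r'1 mulmx1.
  rewrite /tau /= [r _]rM [r' _]r'M -!mulmxA; congr (_ *m _).
  by rewrite !mulmxA -/(r _) -/(r' _) cww.
rewrite /hev2 -hev_tensor -/r -/r' -/tau -gX /coproduct /subst2.
have mX (x y : word bool) : tensor (mono x : ncs k) (mono y) =
    mono ((x, y) : prodm (word bool) (word bool)).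
  exact: tensor_mono.
have h1 : (1 : ncs k) = mono ([::] : word bool) by [].
rewrite hev_fps_subst //; last first.
  by case; rewrite h1 /serA /serB /letter !mX; apply: hom1D; apply: hom1_mono.
apply: hev_eq; apply: wrep_eq => b; rewrite /pairrep.
by case: b; rewrite h1 /serA /serB /letter !mX levD !lev_mono //=
  /tau /= /r /r' !wrep1 /wrep !big_nil mulmxE mulr1 mul1r.
Qed.
End GroupLike.

(** * Matrix representations of t_n *)

Section KohnoRep.
Variables (k : fieldType) (N n : nat) (T : nat -> nat -> 'M[k]_n).

Definition t_rep : Prop :=
  [/\ forall i j : 'I_N, i != j -> T i j = T j i,
      forall i j l : 'I_N, uniq [:: i; j; l] ->
        (T i j + T i l) *m T j l = T j l *m (T i j + T i l)
    & forall i j l m : 'I_N, uniq [:: i; j; l; m] ->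
        T i j *m T l m = T l m *m T i j].

Definition trep (p : tletter N) : 'M[k]_n := T (val p).1 (val p).2.

Lemma tgen_neq (i j : 'I_N) (h : i != j) :
  tgen k i j = letter (Sub (i, j) h : tletter N).
Proof. by rewrite /tgen (insubT (fun p : 'I_N * 'I_N => p.1 != p.2)). Qed.

Lemma hom1_tgen (i j : 'I_N) : hom1 (tgen k i j).
Proof.
have [->|ne] := eqVneq i j; last by rewrite tgen_neq; apply: hom1_letter.
by rewrite /tgen insubF ?eqxx //=; apply: hom1_0.
Qed.

Lemma lev_tgen (i j : 'I_N) :
  lev (wrep trep) 1 (tgen k i j) = if i == j then 0 else T i j.
Proof.
have [->|ne] := eqVneq i j; last by rewrite tgen_neq lev_letter.
by rewrite /tgen insubF ?eqxx //= lev0.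
Qed.

Lemma hev_tgen (i j : 'I_N) : i != j ->
  hev (wrep trep) (tgen k i j) = hX *: cmx (T i j).
Proof. by move=> ne; rewrite tgen_neq hev_letter. Qed.

Hypothesis hT : t_rep.

Lemma t_relator_hev r : t_relator r -> hev (wrep trep) r = 0.
Proof.
case: hT => sym rel3 rel4; case.
- move=> i j ne; rewrite hevD hevN !hev_tgen 1?[j == i]eq_sym //.
  by rewrite (sym _ _ ne) subrr.
- move=> i j l u; rewrite /bracket hevD hevN !hevM; [|exact: wrep_mrep..].
  have /and4P[+ + _ _] := u; rewrite !inE negb_or => /andP[ij il] jl.
  rewrite hevD !hev_tgen // -!scalerDr -!map_mxD -!scalemxAl -!scalemxAr -!map_mxM.
  by rewrite rel3 // subrr.
- move=> i j l m u; rewrite /bracket hevD hevN !hevM; [|exact: wrep_mrep..].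
  have /andP[+ /andP[_ /andP[+ _]]] := u; rewrite !inE !negb_or => /and3P[ij _ _] lm.
  rewrite !hev_tgen // -!scalemxAl -!scalemxAr -!map_mxM.
  by rewrite rel4 // subrr.
Qed.

Lemma t_ideal_hev f : t_ideal f -> hev (wrep trep) f = 0.
Proof.
elim=> [|c u v r g hr _ IH].
  by rewrite -[0 in LHS](subrr 0) hevD hevN subrr.
rewrite hevD IH addr0 hevZ !hevM; [|exact: wrep_mrep..].
by rewrite (t_relator_hev hr) mulmx0 mul0mx scaler0.
Qed.

(** Equality in the completion is equality modulo the ideal in each degree; level d only sees the
    component of degree d. *)
Lemma Ut_eq_hev f g : Ut_eq f g -> hev (wrep trep) f = hev (wrep trep) g.
Proof.
move=> h; apply: hevP => d; apply/eqP; rewrite -subr_eq0 -levN -levD; apply/eqP.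
transitivity (lev (wrep trep) d (homog d (f - g))).
  by apply: eq_big_seq => m; rewrite mem_mons /homog => ->.
have /matrixP e := t_ideal_hev (h d); apply/matrixP => i j.
by rewrite -hevE e !mxE.
Qed.
End KohnoRep.

Section Pentagon.
Variables (k : fieldType) (n : nat) (T : nat -> nat -> 'M[k]_n).

(** The image of t_ij under the insertion morphism followed by T; the diagonal is 0 because
    [tgen a a] is. *)
Definition block_rep (s : seq (seq nat)) (i j : 'I_3) : 'M[k]_n :=
  \sum_(a in blocks 4 s i) \sum_(b in blocks 4 s j) (if a == b then 0 else T a b).

Lemma hev_insertion s (X : ncs k) :
  hev (wrep (trep T)) (insertion (blocks 4 s) (to_t3 X)) =
  hev2 (block_rep s (@Ordinal 3 0 isT) (@Ordinal 3 1 isT))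
       (block_rep s (@Ordinal 3 1 isT) (@Ordinal 3 2 isT)) X.
Proof.
rewrite /insertion hev_fps_subst; [|exact: wrep_mrep|]; last first.
  by move=> p; do 2 (apply: hom1_sum => ?); apply: hom1_tgen.
rewrite /to_t3 /subst2 hev_fps_subst; [|exact: wrep_mrep|]; last first.
  by case; apply: hom1_tgen.
apply: hev_eq; apply: wrep_eq; case; rewrite tgen_neq lev_letter /block_rep /=.
  by rewrite lev_sum; apply: eq_bigr => a _; rewrite lev_sum; apply: eq_bigr => b _;
     rewrite lev_tgen.
by rewrite lev_sum; apply: eq_bigr => a _; rewrite lev_sum; apply: eq_bigr => b _;
   rewrite lev_tgen.
Qed.

Lemma pentagon_hev2 (Phi : ncs k) : pentagon Phi -> t_rep 4 T ->
  hev2 (T 1 2) (T 2 3) Phi *m hev2 (T 0 1 + T 0 2) (T 1 3 + T 2 3) Phi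
    *m hev2 (T 0 1) (T 1 2) Phi =
  hev2 (T 0 1) (T 1 2 + T 1 3) Phi *m hev2 (T 0 2 + T 1 2) (T 2 3) Phi.
Proof.
move=> pent hT; have := Ut_eq_hev hT pent.
rewrite !hevM; [|exact: wrep_mrep..].
rewrite !hev_insertion /block_rep.
(* This expands the sums over the blocks of the five insertions. *)
by do 10 rewrite ?[\sum_(_ in blocks _ _ _) _]big_mkcond /= ?big_ord_recl
  ?big_ord0 ?inE /= ?add0r ?addr0.
Qed.
End Pentagon.

Section GroupLikePentagon.
Variables (k : fieldType) (Phi : ncs k).
Hypothesis PhiU : Phi \is a GRing.unit.
Hypothesis PhiG : grouplike Phi.
Hypothesis PhiP : pentagon Phi.

Lemma lev_deg0 (M : lfMonoidType) n (rho : M -> 'M[k]_n) (f : fps k M) :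
  mrep rho -> lev rho 0 f = (f 1%g)%:M.
Proof.
case=> r1 _; rewrite /lev (bigD1_seq (1%g : M)) ?mons_uniq ?mem_mons ?deg1 //=.
rewrite r1 scalemx1 big1_seq ?addr0 // => m /andP[ne].
by rewrite mem_mons => /eqP /deg_eq0 e; rewrite e eqxx in ne.
Qed.

Lemma sev_deg0 p q (X : ncs k) : sev p q X 0%N = counit X.
Proof.
rewrite /sev /hev2 hevE lev_deg0; last exact: wrep_mrep.
by rewrite mxE eqxx mulr1n.
Qed.

Lemma sev_unit p q (X : ncs k) : X \is a GRing.unit -> sev p q X \is a GRing.unit.
Proof.
by move=> /mulrV/(congr1 (sev p q)); rewrite sevM sev1 => h; apply/unitrPr; exists (sev p q X^-1).
Qed.

Lemma sev_grouplike_add p q p' q' :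
  sev (p + p') (q + q') Phi = sev p q Phi * sev p' q' Phi.
Proof.
rewrite /sev !raddfD /= grouplike_hev2D //; try exact: scalar_mxC.
by rewrite mxE big_ord1.
Qed.

Lemma idem_unit (x : ps k) : x \is a GRing.unit -> x * x = x -> x = 1.
Proof. by move=> xU e; apply: (mulrI xU); rewrite e mulr1. Qed.

Lemma mulmx11C (A B : 'M[k]_1) : A *m B = B *m A.
Proof. by rewrite [A]mx11_scalar scalar_mxC. Qed.

Lemma sev00 : sev 0 0 Phi = 1.
Proof.
apply: idem_unit; first exact: sev_unit.
by rewrite -sev_grouplike_add !addr0.
Qed.

Lemma counit_grouplike : counit Phi = 1.
Proof. by rewrite -(sev_deg0 0 0) sev00 ps1. Qed.

(* Both identities are the pentagon in a one-dimensional representation of    *)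
(* t_4, where only t_12, respectively t_34, acts nontrivially.                *)
Lemma sev_axis_A p : sev p 0 Phi = 1.
Proof.
have hT : t_rep 4 (fun i j => (if (i + j == 1)%N then p else 0)%:M : 'M[k]_1).
  by split=> [i j _|i j l _|i j l m _]; [rewrite addnC|exact: mulmx11C|exact: mulmx11C].
have /matrixP/(_ 0 0) := pentagon_hev2 PhiP hT.
rewrite /= -!raddfD /= !addr0 !hev2_1 -!scalar_mxM !mxE !eqxx sev00 mul1r mulr1 => e.
exact: (idem_unit (sev_unit _ _ PhiU)).
Qed.

Lemma sev_axis_B q : sev 0 q Phi = 1.
Proof.
have hT : t_rep 4 (fun i j => (if (i + j == 5)%N then q else 0)%:M : 'M[k]_1).
  by split=> [i j _|i j l _|i j l m _]; [rewrite addnC|exact: mulmx11C|exact: mulmx11C].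
have /matrixP/(_ 0 0) := pentagon_hev2 PhiP hT.
rewrite /= -!raddfD /= !addr0 !add0r !hev2_1 -!scalar_mxM !mxE !eqxx sev00 mul1r mulr1 => e.
exact: (idem_unit (sev_unit _ _ PhiU)).
Qed.

(** Group-likeness makes the value additive-to-multiplicative in (p, q), and it is 1 on both axes:
    Phi^ab = 1. *)
Lemma sev_grouplike p q : sev p q Phi = 1.
Proof.
by rewrite -[p]addr0 -[q]add0r sev_grouplike_add sev_axis_A sev_axis_B mulr1.
Qed.

(** Scalars commute with A and B, so by group-likeness the shift only contributes a value of Phi^ab,
    which is 1. *)
Lemma hev2_shift n (A B : 'M[k]_n) p q :
  hev2 (A + p%:M) (B + q%:M) Phi = hev2 A B Phi.
Proof.
rewrite grouplike_hev2D //; try exact/esym/scalar_mxC; try exact/scalar_mxC.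
by rewrite hev2_scalar sev_grouplike mulmx1.
Qed.

Definition Fh p q : ps k := sev p q (1 + rpartB Phi * serB).

Lemma FhE p q : Fh p q = 1 + sev p q (rpartB Phi * serB).
Proof. by rewrite /Fh sevD sev1. Qed.

(** At A = 0 the decomposition of Phi reduces to 1 + Phi_B B, and Phi^ab = 1. *)
Lemma Fh0q q : Fh 0 q = 1.
Proof.
rewrite FhE -[RHS](sev_axis_B q) [in RHS](rpart_decomp Phi) !sevD counit_grouplike.
rewrite scale1r sev1 [sev _ _ (_ * serA)]sevM [sev _ _ serA]/sev hev2_serA.
by rewrite !mxE rmorph0 !mulr0 addr0.
Qed.

(** Shifting A by - a reduces to the case A u = 0 of [hev2_column]; hence the argument p - a of
    F. *)
Lemma hev2_Phi_column n (A B : 'M[k]_n) (u e : 'cV[k]_n) a p q s :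
  A *m u = a *: u -> B *m u = s *: e -> A *m e = p *: e -> B *m e = q *: e ->
  q%:A *: (hev2 A B Phi *m cmx u) =
    q%:A *: cmx u + (s%:A * (Fh (p - a) q - 1)) *: cmx e.
Proof.
move=> Au Bu Ae Be; rewrite -(hev2_shift A B (- a) 0) raddf0 addr0.
rewrite (@hev2_column _ _ _ _ u e (p - a) q s) //; first last.
- by rewrite mulmxDl mul_scalar_mx Ae -scalerDl.
- by rewrite mulmxDl mul_scalar_mx Au scaleNr subrr.
by rewrite counit_grouplike mulr1 FhE [1 + _]addrC addrK.
Qed.

(** In degree d every word acts by a multiple of A^d, and the coefficients add up to that of
    Phi^ab. *)
Lemma hev2_collinear n (A : 'M[k]_n) s t : hev2 (s *: A) (t *: A) Phi = 1%:M.
Proof.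
rewrite -(hev1 (wrep_mrep (pairrep (s *: A) (t *: A)))).
apply: hevP => d; rewrite lev1; last exact: wrep_mrep.
have -> : lev (wrep (pairrep (s *: A) (t *: A))) d Phi =
    sev s t Phi d *: A ^+ d.
  rewrite /sev /hev2 hevE /lev summxE scaler_suml.
  apply: eq_big_seq => w; rewrite mem_mons => /eqP <-; rewrite mxE -scalerA.
  congr (_ *: _); rewrite /deg /=; elim: w => [|b w IH].
    by rewrite /wrep !big_nil mxE eqxx scale1r.
  rewrite /wrep !big_cons exprS /= in IH *; rewrite IH mxE big_ord1.
  by case: b; rewrite /= mxE eqxx -!mulmxE -scalemxAl -scalemxAr scalerA.
by rewrite sev_grouplike ps1; case: d => [|d]; rewrite ?scale1r ?scale0r.
Qed.

(** With A + B + C = 0, the pentagon is applied to the representation of t_4 given by t_12, t_34 ->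
    A, t_23, t_14 -> B and t_13, t_24 -> C. Three of its five factors then have collinear arguments
    and equal 1. *)
Lemma hev2_dual n (A B : 'M[k]_n) : hev2 B A Phi *m hev2 A B Phi = 1%:M.
Proof.
pose C := - A - B.
pose T (i j : nat) : 'M[k]_n :=
  if (i + j == 1)%N || (i + j == 5)%N then A else if (i + j == 3)%N then B else C.
have ABC : A + B = - C by rewrite /C -opprD opprK.
have hT : t_rep 4 T.
  (* The three pairs inside any triple of strands are sent to A, B and C in some order, and these
     sum to 0. *)
  have T3 (i j l : 'I_4) : uniq [:: i; j; l] -> T i j + T i l = - T j l.
    by case: i j l => [[|[|[|[|i]]]] hi] // [[|[|[|[|j]]]] hj] //
      [[|[|[|[|l]]]] hl] //= _; rewrite /T /= /C; apply/matrixP => a b;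
      rewrite !mxE; ring.
  split=> [i j _|i j l h|i j l m]; first by rewrite /T addnC.
    by rewrite T3 // mulNmx mulmxN.
  case: i j l m => [[|[|[|[|i]]]] hi] // [[|[|[|[|j]]]] hj] //
    [[|[|[|[|l]]]] hl] // [[|[|[|[|m]]]] hm] //.
have := pentagon_hev2 PhiP hT; rewrite /T /=.
have -> : hev2 (A + C) (C + A) Phi = 1%:M.
  by rewrite addrC -[X in hev2 X X _]scale1r hev2_collinear.
have -> : hev2 A (B + C) Phi = 1%:M.
  have -> : B + C = (-1) *: A by rewrite /C addrC subrK scaleN1r.
  by rewrite -[X in hev2 X _ _]scale1r hev2_collinear.
have -> : hev2 (C + B) A Phi = 1%:M.
  have -> : C + B = (-1) *: A by rewrite /C subrK scaleN1r.
  by rewrite -[X in hev2 _ X _]scale1r hev2_collinear.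
by rewrite !mulmx1.
Qed.
End GroupLikePentagon.

Lemma ord2 (P : 'I_2 -> Prop) : P 0 -> P 1 -> forall i, P i.
Proof.
move=> p0 p1 [[|[|i]] hi] //.
  by rewrite (_ : Ordinal hi = 0) //; apply: val_inj.
by rewrite (_ : Ordinal hi = 1) //; apply: val_inj.
Qed.

Lemma sum2 (V : nmodType) (F : 'I_2 -> V) : \sum_i F i = F 0 + F 1.
Proof.
rewrite !big_ord_recl big_ord0 addr0; congr (_ + F _); exact: val_inj.
Qed.

(** * The Gassner representation and the cocycle relation *)

Section Gassner.
Variables (k : fieldType) (N : nat) (x : nat -> k).

(* The infinitesimal Gassner representation: t_ij maps v to                   *)
(* (x_j v_i - x_i v_j) (e_i - e_j).                                           *)
Definition gassner_col (i j : nat) : 'cV[k]_N :=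
  \col_(a < N) ((val a == i)%:R - (val a == j)%:R).

Definition gassner_row (i j : nat) : 'rV[k]_N :=
  \row_(b < N) (x j * (val b == i)%:R - x i * (val b == j)%:R).

Definition gassner (i j : nat) : 'M[k]_N := gassner_col i j *m gassner_row i j.

Lemma gassner_row_mul (i j : 'I_N) (v : 'cV[k]_N) :
  gassner_row i j *m v = (x j * v i 0 - x i * v j 0)%:M.
Proof.
apply/matrixP => a b; rewrite !ord1 !mxE eqxx mulr1n.
transitivity (\sum_l (x j * (l == i)%:R * v l 0 - x i * (l == j)%:R * v l 0)).
  by apply: eq_bigr => l _; rewrite mxE mulrBl.
rewrite sumrB (bigD1 i) //= eqxx mulr1 big1 ?addr0; last first.
  by move=> l /negPf ->; rewrite mulr0 mul0r.
rewrite (bigD1 j) //= eqxx mulr1 big1 ?addr0 //.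
by move=> l /negPf ->; rewrite mulr0 mul0r.
Qed.

Lemma gassner_mul (i j : 'I_N) (v : 'cV[k]_N) :
  gassner i j *m v = (x j * v i 0 - x i * v j 0) *: gassner_col i j.
Proof. by rewrite -mulmxA gassner_row_mul mul_mx_scalar. Qed.

Lemma gassnerM (i j l m : 'I_N) :
  gassner i j *m gassner l m =
  (x j * ((i == l)%:R - (i == m)%:R) - x i * ((j == l)%:R - (j == m)%:R)) *:
    (gassner_col i j *m gassner_row l m).
Proof. by rewrite /gassner mulmxA gassner_mul !mxE -scalemxAl. Qed.

Lemma gassner_rep : t_rep N gassner.
Proof.
split.
- move=> i j _; apply/matrixP => a b; rewrite !mxE !big_ord1 !mxE; ring.
- move=> i j l /and4P[+ + _ _]; rewrite !inE negb_or => /andP[].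
  move=> /negPf ij /negPf il /negPf jl.
  rewrite mulmxDl mulmxDr !gassnerM [l == i]eq_sym [l == j]eq_sym [j == i]eq_sym !eqxx ij il jl.
  by apply/matrixP => a b; rewrite !mxE !big_ord1 !mxE /=; ring.
- move=> i j l m /and4P[+ + + _]; rewrite !inE !negb_or => /and3P[].
  move=> /negPf ij /negPf il /negPf im /andP[/negPf jl /negPf jm] /negPf lm.
  rewrite !gassnerM [l == i]eq_sym [l == j]eq_sym [m == i]eq_sym [m == j]eq_sym il im jl jm.
  by rewrite !subr0 !mulr0 subr0 !scale0r.
Qed.
End Gassner.

(** * Phi acts on a plane with determinant 1 *)

Section Determinant.
Variables (k : fieldType) (Phi : ncs k).
Hypothesis PhiU : Phi \is a GRing.unit.
Hypothesis PhiG : grouplike Phi.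
Hypothesis PhiP : pentagon Phi.

(* On k^2 (x) k^2, [kron1 A] and [kron2 A] are A (x) 1 and 1 (x) A, [alt2] is *)
(* the alternating form, on which A (x) 1 + 1 (x) A acts by \tr A, [emb1 l]   *)
(* is u |-> u (x) e_l and [emb2] is u |-> e_0 (x) u.                          *)
Let kron1 (A : 'M[k]_2) : 'M_(2 + 2) :=
  block_mx (A 0 0)%:M (A 0 1)%:M (A 1 0)%:M (A 1 1)%:M.
Let kron2 (A : 'M[k]_2) : 'M_(2 + 2) := block_mx A 0 0 A.
Let alt2 : 'M[k]_(1, 2 + 2) := row_mx (delta_mx 0 1) (- delta_mx 0 0).
Let emb1 (l : 'I_2) : 'M[k]_(2 + 2, 2) := col_mx (delta_mx l 0) (delta_mx l 1).
Let emb2 : 'M[k]_(2 + 2, 2) := col_mx 1%:M 0.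

(** By group-likeness Phi acts on the tensor square of the plane by Y (x) Y. The alternating form is
    an intertwiner to the line where A and B act by their traces, and there Phi is 1. *)
Lemma det_hev2 (A B : 'M[k]_2) : let Y := hev2 A B Phi in
  Y 0 0 * Y 1 1 - Y 0 1 * Y 1 0 = 1.
Proof.
have comm C D : kron1 C *m kron2 D = kron2 D *m kron1 C.
  by rewrite /kron1 /kron2 !mulmx_block !mulmx0 !mul0mx !addr0 !add0r !scalar_mxC.
have h1 l C : kron1 C *m emb1 l = emb1 l *m C.
  rewrite /kron1 /emb1 mul_block_col mul_col_mx !mul_scalar_mx; congr col_mx.
    by apply/matrixP; move: l; do 3 (apply: ord2);
      rewrite !mxE !sum2 !mxE /=; ring.
  by apply/matrixP; move: l; do 3 (apply: ord2);
    rewrite !mxE !sum2 !mxE /=; ring.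
have h2 C : kron2 C *m emb2 = emb2 *m C.
  by rewrite /kron2 /emb2 mul_block_col mul_col_mx !mulmx1 !mulmx0 !mul0mx mul1mx !addr0.
have h3 C : (\tr C)%:M *m alt2 = alt2 *m (kron1 C + kron2 C).
  rewrite /alt2 /kron1 /kron2 add_block_mx mul_row_block mul_scalar_mx scale_row_mx.
  rewrite /mxtrace !sum2.
  congr row_mx; apply/rowP; apply: ord2;
    rewrite !mxE !sum2 !mxE /=; ring.
have e3 : cmx alt2 = cmx alt2 *m hev2 (kron1 A) (kron1 B) Phi
                              *m hev2 (kron2 A) (kron2 B) Phi.
  rewrite -mulmxA -grouplike_hev2D // -(hev2_intertwine _ (h3 A) (h3 B)).
  by rewrite hev2_1 sev_grouplike // mul1mx.
(* The identity of forms is evaluated at e_0 (x) e_1, where the alternating form is 1. *)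
have /matrixP/(_ 0 1) := congr1 (mulmx^~ (cmx emb2)) e3.
rewrite -[in RHS]mulmxA (hev2_intertwine _ (h2 A) (h2 B)) mulmxA.
have e4 l : (cmx alt2 *m hev2 (kron1 A) (kron1 B) Phi *m cmx emb2) 0 l =
            (cmx alt2 *m cmx (emb1 l) *m hev2 A B Phi) 0 0.
  rewrite -[in RHS]mulmxA -(hev2_intertwine _ (h1 l A) (h1 l B)) mulmxA.
  rewrite ![(_ *m cmx _) 0 _]mxE; apply: eq_bigr => a _; congr (_ * _).
  rewrite !mxE; case: splitP => b _; rewrite !mxE.
    by move: l b; do 2 (apply: ord2).
  by move: l b; do 2 (apply: ord2).
rewrite -!map_mxM [X in _ = X]mxE !sum2 !e4 -!map_mxM.
rewrite /alt2 /emb2 /emb1 !mul_row_col mulmx1 mulmx0 addr0.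
move: (hev2 A B Phi) => Y; rewrite !mxE !sum2 !mxE !sum2 !mxE /=.
rewrite !(mulr0, mul0r, mulr1, mul1r, addr0, add0r, oppr0, scale0r, scale1r, scaleN1r).
by rewrite mulN1r => ->; ring.
Qed.
End Determinant.

Section Cocycle.
Variables (k : fieldType) (Phi : ncs k).
Hypothesis PhiU : Phi \is a GRing.unit.
Hypothesis PhiG : grouplike Phi.
Hypothesis PhiP : pentagon Phi.

Local Notation F := (Fh Phi).
Local Notation "a %:K" := (a%:A : ps k) (at level 2, format "a %:K").

Lemma unit_const (c : k) : c != 0 -> c%:K \is a GRing.unit.
Proof. by move=> c0; apply: (rmorph_unit (in_alg (ps k))); rewrite unitfE. Qed.

Lemma cmxZ m n (c : k) (A : 'M[k]_(m, n)) : cmx (c *: A) = c%:K *: cmx A.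
Proof. exact: map_mxZ. Qed.

Lemma cmxD m n (A B : 'M[k]_(m, n)) : cmx (A + B) = cmx A + cmx B.
Proof. exact: map_mxD. Qed.

Definition vec2 (R : Type) (a b : R) : 'cV[R]_2 := \col_i (if i == 0 then a else b).

Definition vec4 (a b c d : k) : 'cV[k]_4 := \col_i nth 0 [:: a; b; c; d] i.

Definition mA (x y : k) : 'M[k]_2 :=
  \matrix_(i, j) (if i == 0 then if j == 0 then x + y else - x else 0).
Definition mB (y z : k) : 'M[k]_2 :=
  \matrix_(i, j) (if i == 0 then 0 else if j == 0 then - z else y + z).

Ltac vec_brute := rewrite ?mulmxDl -?mulmxA; apply/colP => -[[|[|[|[|i]]]] hi] //;
  rewrite !mxE ?big_ord1 ?mxE /= ?big_ord_recl ?big_ord0 ?mxE /=; ring.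

(** Every factor of the pentagon but Phi(t_23, t_34) either fixes the vectors it meets or moves them
    as in [hev2_Phi_column]; q and x + y clear the denominators of that lemma. The remaining factor
    acts on a plane, as Y. *)
Lemma gauss_relation (x y z : k) (q := x + y + z)
    (Y := hev2 (mA x y) (mB y z) Phi) :
  Y *m ((z%:K * F (- (x + y)) q) *: cmx (vec2 x (x + y))
        + (q%:K * y%:K * F (- x) (x + y)) *: cmx (vec2 1 0)) =
  ((x + y)%:K * F (- x) q) *: cmx (vec2 (y + z) z).
Proof.
pose T := gassner 4 (nth 0 [:: 0; x; y; z]).
have pent := pentagon_hev2 PhiP (gassner_rep 4 (nth 0 [:: 0; x; y; z])).
rewrite -/T in pent.
(* The pentagon is applied to f2. The last three strands kill f; they         *)
(* preserve the plane spanned by d1, e and e', where, in the basis given by   *)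
(* the columns of J, the letters of Phi(t_23, t_34) act by mA and mB.         *)
pose f2 := vec4 1 (-1) 0 0; pose d1 := vec4 0 (-1) 1 0.
pose e := vec4 0 (- (y + z)) y z; pose e' := vec4 0 (- x) (- y) (x + y).
pose g := vec4 (x + y) (- x) (- y) 0; pose f := vec4 q (- x) (- y) (- z).
have E1 : hev2 (T 0 2 + T 1 2) (T 2 3) Phi *m cmx f2 = cmx f2.
  rewrite (@hev2_eigen _ _ _ _ _ y 0) ?sev_grouplike ?scale1r //.
    by rewrite /T /gassner; vec_brute.
  by rewrite /T /gassner; vec_brute.
have E2 : q%:K *: (hev2 (T 0 1) (T 1 2 + T 1 3) Phi *m cmx f2) =
    cmx f + F (- x) q *: cmx e.
  rewrite (@hev2_Phi_column _ _ PhiU PhiG PhiP _ _ _ f2 e x 0 q 1); first last.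
  - by rewrite /T /gassner /q; vec_brute.
  - by rewrite /T /gassner; vec_brute.
  - by rewrite /T /gassner; vec_brute.
  - by rewrite /T /gassner; vec_brute.
  rewrite sub0r scale1r mul1r scalerBl scale1r -cmxZ.
  have -> : q *: f2 = f + e by rewrite /f /q; vec_brute.
  by rewrite cmxD -addrA [cmx e + _]addrC subrK.
have E3 : (x + y)%:K *: (hev2 (T 0 1) (T 1 2) Phi *m cmx f2) =
    cmx g + (y%:K * F (- x) (x + y)) *: cmx d1.
  rewrite (@hev2_Phi_column _ _ PhiU PhiG PhiP _ _ _ f2 d1 x 0 (x + y) y); first last.
  - by rewrite /T /gassner; vec_brute.
  - by rewrite /T /gassner; vec_brute.
  - by rewrite /T /gassner; vec_brute.
  - by rewrite /T /gassner; vec_brute.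
  rewrite sub0r mulrBr mulr1 scalerBl -!cmxZ.
  have -> : (x + y) *: f2 = g + y *: d1 by vec_brute.
  by rewrite cmxD -addrA [cmx (_ *: d1) + _]addrC subrK.
have E4 : q%:K *: (hev2 (T 0 1 + T 0 2) (T 1 3 + T 2 3) Phi *m cmx g) =
    (x + y)%:K *: cmx f + (z%:K * F (- (x + y)) q) *: cmx e'.
  rewrite (@hev2_Phi_column _ _ PhiU PhiG PhiP _ _ _ g e' (x + y) 0 q z); first last.
  - by rewrite /T /gassner /q; vec_brute.
  - by rewrite /T /gassner; vec_brute.
  - by rewrite /T /gassner; vec_brute.
  - by rewrite /T /gassner; vec_brute.
  rewrite sub0r mulrBr mulr1 scalerBl -!cmxZ.
  have -> : q *: g = (x + y) *: f + z *: e' by rewrite /f /q; vec_brute.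
  by rewrite cmxD -addrA [cmx (_ *: e') + _]addrC subrK.
have E5 : hev2 (T 0 1 + T 0 2) (T 1 3 + T 2 3) Phi *m cmx d1 = cmx d1.
  rewrite (@hev2_eigen _ _ _ _ _ 0 z) ?sev_grouplike ?scale1r //.
    by rewrite /T /gassner; vec_brute.
  by rewrite /T /gassner; vec_brute.
have E6 : hev2 (T 1 2) (T 2 3) Phi *m cmx f = cmx f.
  rewrite (@hev2_eigen _ _ _ _ _ 0 0) ?sev_grouplike ?scale1r //.
    by rewrite /T /gassner /f /q; vec_brute.
  by rewrite /T /gassner /f /q; vec_brute.
pose J : 'M[k]_(4, 2) := \matrix_(i, j)
  nth 0 (if j == 0 then [:: 0; -1; 1; 0] else [:: 0; 0; -1; 1]) i.
have E7 : hev2 (T 1 2) (T 2 3) Phi *m cmx J = cmx J *m Y.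
  by apply: hev2_intertwine; rewrite /T /gassner -mulmxA; apply/matrixP;
    move=> [[|[|[|[|i]]]] hi] //; apply: ord2;
    rewrite !mxE ?big_ord1 ?mxE /= ?big_ord_recl ?big_ord0 ?mxE /=; ring.
pose L : 'M[k]_(2, 4) := \matrix_(i, j)
  nth 0 (if i == 0 then [:: 0; -1; 0; 0] else [:: 0; 0; 0; 1]) j.
have LJ : L *m J = 1%:M.
  by apply/matrixP; do 2 (apply: ord2); rewrite !mxE !big_ord_recl big_ord0 !mxE /=; ring.
have Jv a b : J *m vec2 a b = vec4 0 (- a) (a - b) b.
  by vec_brute.
(* Both sides of the pentagon, applied to q (x + y) [f2], contain the term (x + y) [f], which
   cancels; what remains lies in the plane. *)
have main : hev2 (T 1 2) (T 2 3) Phi *m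
    ((z%:K * F (- (x + y)) q) *: cmx e' + (q%:K * y%:K * F (- x) (x + y)) *: cmx d1) =
  ((x + y)%:K * F (- x) q) *: cmx e.
  have rhs : (q%:K * (x + y)%:K) *: (hev2 (T 0 1) (T 1 2 + T 1 3) Phi
      *m hev2 (T 0 2 + T 1 2) (T 2 3) Phi *m cmx f2) =
      (x + y)%:K *: cmx f + ((x + y)%:K * F (- x) q) *: cmx e.
    by rewrite -mulmxA E1 [q%:K * _]mulrC -[in LHS]scalerA E2 scalerDr scalerA.
  move: rhs; rewrite -pent -!mulmxA -[in X in X = _ -> _]scalerA.
  rewrite 2![(x + y)%:K *: (_ *m _)]scalemxAr E3 [_ *m (cmx g + _)]mulmxDr.
  rewrite -[_ *m (_ *: cmx d1)]scalemxAr E5 [q%:K *: (_ *m _)]scalemxAr.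
  rewrite scalerDr E4 scalerA.
  rewrite [q%:K * (_ * _)]mulrA -addrA mulmxDr -[_ *m (_ *: cmx f)]scalemxAr E6.
  exact: addrI.
have e'J : cmx e' = cmx J *m cmx (vec2 x (x + y)).
  by rewrite -map_mxM Jv; congr (cmx (vec4 _ _ _ _)); ring.
have d1J : cmx d1 = cmx J *m cmx (vec2 1 0).
  by rewrite -map_mxM Jv; congr (cmx (vec4 _ _ _ _)); ring.
have eJ : cmx e = cmx J *m cmx (vec2 (y + z) z).
  by rewrite -map_mxM Jv; congr (cmx (vec4 _ _ _ _)); ring.
have cancelJ (u v : 'cV[ps k]_2) : cmx J *m u = cmx J *m v -> u = v.
  move=> /(congr1 (mulmx (cmx L))).
  by rewrite !mulmxA -map_mxM LJ map_mx1 !mul1mx.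
apply: cancelJ; move: main; rewrite e'J d1J eJ !scalemxAr -mulmxDr mulmxA E7.
by rewrite -mulmxA.
Qed.

Lemma vec2K (R : nzRingType) (a b c d : R) : vec2 a b = vec2 c d -> a = c /\ b = d.
Proof. by move=> /colP h; split; [have := h 0|have := h 1]; rewrite !mxE. Qed.

Lemma cmx_vec2 (a b : k) : cmx (vec2 a b) = vec2 a%:K b%:K.
Proof. by apply/colP; apply: ord2; rewrite !mxE. Qed.

Lemma vec2Z (a b c : ps k) : c *: vec2 a b = vec2 (c * a) (c * b).
Proof. by apply/colP; apply: ord2; rewrite !mxE. Qed.

Lemma vec2D (a b c d : ps k) : vec2 a b + vec2 c d = vec2 (a + c) (b + d).
Proof. by apply/colP; apply: ord2; rewrite !mxE. Qed.

Lemma mulmx_vec2 (Y : 'M[ps k]_2) (a b : ps k) :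
  Y *m vec2 a b = vec2 (Y 0 0 * a + Y 0 1 * b) (Y 1 0 * a + Y 1 1 * b).
Proof. by apply/colP; apply: ord2; rewrite !mxE sum2 !mxE. Qed.

(** Let [gauss_relation] say Y v = w for (x, y, z) and Y' v' = w' for (z, y, x). Exchanging the
    coordinates turns Y' into Phi(B, A), the inverse of Y, so that Y also sends the swapped w' to
    the swapped v'. As Y has determinant 1, det(v, S w') = det(w, S v'), and there the other values
    of F drop out. *)
Lemma Fh_relation (x y z : k) (q := x + y + z) :
  y != 0 -> q != 0 -> x + y != 0 -> y + z != 0 ->
  F (- z) q * F (- x) (x + y) = F (- x) q * F (- z) (z + y).
Proof.
move=> y0 q0 xy0 yz0.
set Y := hev2 (mA x y) (mB y z) Phi.
have r1 := gauss_relation x y z; rewrite /= -/Y -/q in r1.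
have r2 := gauss_relation z y x; rewrite /= (_ : z + y + x = q) in r2; last by rewrite /q; ring.
set Y' := hev2 (mA z y) (mB y x) Phi in r2.
pose S : 'M[k]_2 := \matrix_(i, j) (i != j)%:R.
have Y'E : cmx S *m Y' = hev2 (mB y z) (mA x y) Phi *m cmx S.
  by symmetry; apply: hev2_intertwine; apply/matrixP; do 2 (apply: ord2);
    rewrite !mxE !sum2 !mxE /=; ring.
have YY' := hev2_dual PhiU PhiG PhiP (mB y z) (mA x y).
have Sv a b : cmx S *m vec2 a b = vec2 b a.
  by rewrite mulmx_vec2 !mxE /= !(scale0r, scale1r, mul0r, mul1r, add0r, addr0).
have := congr1 (fun X => Y *m (cmx S *m X)) r2.
rewrite !mulmxA -[Y *m _ *m Y']mulmxA Y'E [Y *m (_ *m _)]mulmxA YY' mul1mx.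
rewrite -!mulmxA !cmx_vec2 !vec2Z vec2D !Sv mulmx_vec2 => /vec2K[p1 p2].
move: r1; rewrite !cmx_vec2 !vec2Z vec2D mulmx_vec2 => /vec2K[p3 p4].
have dY := det_hev2 PhiU PhiG PhiP (mA x y) (mB y z); rewrite /= -/Y in dY.
rewrite !(scale0r, scale1r, mulr0, mulr1, addr0) [z + y]addrC [y + x]addrC in p1 p2 p3 p4 *.
pose U := q%:K * y%:K * (x + y)%:K * (y + z)%:K.
have UU : U \is a GRing.unit by rewrite /U !unitrM !unit_const.
apply: (mulrI UU); rewrite -[LHS]mulr1 -dY /U.
(* The middle term is det(w, S v'), the determinant of the two images under Y. *)
transitivity ((x + y)%:K * F (- x) q * (y + z)%:K *
    (x%:K * F (- (y + z)) q * z%:K + q%:K * y%:K * F (- z) (y + z))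
  - (x + y)%:K * F (- x) q * z%:K * (x%:K * F (- (y + z)) q * (y + z)%:K)); last by ring.
by rewrite -p3 -p4 p1 p2; ring.
Qed.
End Cocycle.

(** * Values of F at pairs of scalars *)

Section Symmetry.
Variables (k : fieldType) (Phi : ncs k).
Hypothesis PhiU : Phi \is a GRing.unit.
Hypothesis PhiG : grouplike Phi.
Hypothesis PhiP : pentagon Phi.

Local Notation F := (Fh Phi).
Local Notation "a %:K" := (a%:A : ps k) (at level 2, format "a %:K").

(** This is [Fh_relation] in the variables p = - x, r = - z and q = x + y + z. *)
Lemma Fh_cocycle (p q r : k) :
  q != 0 -> p + q != 0 -> q + r != 0 -> p + q + r != 0 ->
  F r q * F p (q + r) = F p q * F r (p + q).
Proof.
move=> q0 pq0 qr0 pqr0; have := @Fh_relation _ _ PhiU PhiG PhiP (- p) (p + q + r) (- r).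
rewrite /= !opprK (_ : - p + (p + q + r) = q + r); last by ring.
rewrite (_ : q + r - r = q); last by ring.
rewrite (_ : p + q + r - r = p + q); last by ring.
rewrite (_ : - r + (p + q + r) = p + q); last by ring.
exact.
Qed.

(* The infinitesimal affine map t |-> a t + s, acting on the vectors (t, 1)   *)
Definition aff (a s : k) : 'M[k]_2 :=
  \matrix_(i, j) (if i == 0 then if j == 0 then a else s else 0).

Lemma aff_vec2 a s u v : aff a s *m vec2 u v = vec2 (a * u + s * v) 0.
Proof. by apply/colP; apply: ord2; rewrite !mxE sum2 !mxE /=; ring. Qed.

(** Phi acts by a translation, since Phi^ab = 1 on the translation direction (1, 0). It is computed
    at the fixed point u of the first map by [hev2_Phi_column]; the second map moves u with velocity
    b u + t. *)
Lemma hev2_affine a b s t u (v : ps k) : a * u = - s -> b != 0 ->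
  hev2 (aff a s) (aff b t) Phi *m vec2 v 1 =
    vec2 (v + ((b * u + t) / b)%:K * (F a b - 1)) 1.
Proof.
move=> hu b0.
have h0 : hev2 (aff a s) (aff b t) Phi *m vec2 1 0 = vec2 1 0.
  have := @hev2_eigen _ _ (aff a s) (aff b t) (vec2 1 0) a b Phi.
  rewrite cmx_vec2 sev_grouplike // !scale1r scale0r => -> //.
    by rewrite aff_vec2; apply/colP; apply: ord2; rewrite !mxE /=; ring.
  by rewrite aff_vec2; apply/colP; apply: ord2; rewrite !mxE /=; ring.
have h1 : hev2 (aff a s) (aff b t) Phi *m vec2 u%:K 1 =
    vec2 (u%:K + ((b * u + t) / b)%:K * (F a b - 1)) 1.
  have := @hev2_Phi_column _ _ PhiU PhiG PhiP _ (aff a s) (aff b t)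
    (vec2 u 1) (vec2 1 0) 0 a b (b * u + t).
  rewrite !aff_vec2 hu !mulr1 !mulr0 !addr0 addNr subr0 scale0r.
  have e0 : vec2 0 0 = 0 :> 'cV[k]_2 by apply/colP; apply: ord2; rewrite !mxE.
  rewrite e0 => /(_ erefl).
  have eZ c : c *: vec2 1 0 = vec2 c 0 :> 'cV[k]_2.
    by apply/colP; apply: ord2; rewrite !mxE ?mulr1 ?mulr0.
  rewrite !eZ => /(_ erefl erefl erefl)/(congr1 (fun X => (b^-1)%:K *: X)).
  have bK : (b^-1)%:K * b%:K = 1 by rewrite -scalerAl mul1r scalerA mulVf // scale1r.
  rewrite !cmx_vec2 !scale1r scale0r scalerDr !scalerA bK !scale1r => ->.
  rewrite vec2Z vec2D mulr0 addr0 mulr1; congr (vec2 (_ + _) _).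
  by rewrite mulrA -scalerAl mul1r scalerA [b^-1 * _]mulrC.
have -> : vec2 v 1 = vec2 u%:K 1 + (v - u%:K) *: vec2 1 0.
  by rewrite vec2Z vec2D mulr1 mulr0 addr0 addrC subrK.
rewrite mulmxDr -scalemxAr h0 h1 vec2Z vec2D mulr1 mulr0 addr0; congr (vec2 _ _).
ring.
Qed.

(** For two maps with fixed points 0 and -1, Phi(A, B) and Phi(B, A) are the translations by F(p, q)
    - 1 and 1 - F(q, p), which cancel by duality. *)
Lemma Fh_sym p q : p != 0 -> q != 0 -> F p q = F q p.
Proof.
move=> p0 q0; have := hev2_dual PhiU PhiG PhiP (aff p 0) (aff q q).
move=> /(congr1 (mulmx^~ (vec2 0 1))); rewrite mul1mx -mulmxA.
rewrite (@hev2_affine _ _ _ _ 0) ?mulr0 ?oppr0 //.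
rewrite (@hev2_affine _ _ _ _ (-1)) ?mulrN1 //. rewrite !addr0 !add0r mulNr !divff //.
rewrite scaleNr !scale1r mulN1r mul1r => /vec2K[e _].
apply/eqP; rewrite -subr_eq0; apply/eqP; rewrite -[RHS]e; ring.
Qed.
End Symmetry.

(** * From identities at scalars to identities of series *)

Section Specialisation.
Variable k : fieldType.
Hypothesis char0 : [pchar k] =i pred0.

Lemma natr_neq0 n : n.+1%:R != 0 :> k.
Proof. by rewrite ((pcharf0P k).1 char0). Qed.

Lemma natr_inj : injective (fun n : nat => n%:R : k).
Proof.
move=> m n /eqP; wlog le_mn : m n / (m <= n)%N.
  by move=> h; case/orP: (leq_total m n) => /h // {}h; rewrite eq_sym => /h ->.
rewrite eq_sym -subr_eq0 -natrB // ((pcharf0P k).1 char0) subn_eq0 => le_nm.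
by apply/eqP; rewrite eqn_leq le_mn.
Qed.

Lemma poly_cofinite0 (P : {poly k}) (s : seq k) :
  (forall r, r \notin s -> P.[r] = 0) -> P = 0.
Proof.
move=> h; pose Q := P * \prod_(a <- s) ('X - a%:P).
have Q0 : Q = 0.
  apply: contraTeq isT => /max_poly_roots hQ.
  have /hQ : all (root Q) [seq n%:R | n <- iota 0 (size Q)].
    apply/allP => r _; rewrite /root /Q hornerM.
    case: (boolP (r \in s)) => [rs|/h ->]; last by rewrite mul0r.
    have /eqP -> : root (\prod_(a <- s) ('X - a%:P)) r by rewrite root_prod_XsubC.
    by rewrite mulr0.
  rewrite map_inj_uniq ?iota_uniq; last exact: natr_inj.
  by rewrite size_map size_iota ltnn => /(_ isT).
move/eqP: Q0; rewrite mulf_eq0 => /orP[/eqP //|].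
by rewrite (negPf (monic_neq0 (monic_prod_XsubC s xpredT id))).
Qed.

Definition erep (p q : k) (m : prodm expo expo) : 'M[k]_1 := (p ^+ m.1 * q ^+ m.2)%:M.

Lemma erep_mrep p q : mrep (erep p q).
Proof.
split=> [|u v]; first by rewrite /erep /= mulr1.
by rewrite /erep -scalar_mxM /= !exprD; congr (_%:M); ring.
Qed.

Definition spec p q (f : fps k (prodm expo expo)) : ps k := hev (erep p q) f 0 0.

Lemma spec_coef p q f (d : nat) :
  spec p q f d = \sum_(i < d.+1) f ((i : nat), (d - i)%N) * p ^+ i * q ^+ (d - i).
Proof.
rewrite /spec hevE /lev big_prodm_mons summxE; apply: eq_bigr => i _.
by rewrite !big_seq1 !mxE eqxx mulr1n mulrA.
Qed.

Lemma specM p q f g : spec p q (f * g) = spec p q f * spec p q g.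
Proof. by rewrite /spec hevM; [rewrite mxE big_ord1|exact: erep_mrep]. Qed.

(** The coefficient of h^d at (p h, h) is a polynomial in p whose coefficients are those of the
    series in total degree d; k is infinite. *)
Lemma spec_inj f g (s : seq k) :
  (forall p, p \notin s -> spec p 1 f = spec p 1 g) -> f = g.
Proof.
move=> h; apply/fpsP => -[i j]; set d := (i + j)%N.
pose P := \poly_(l < d.+1) (f (l, (d - l)%N) - g (l, (d - l)%N)).
have P0 : P = 0.
  apply: (@poly_cofinite0 _ s) => r /h e; rewrite horner_poly.
  have := congr1 (fun u : ps k => u d) e; rewrite !spec_coef => {}e.
  rewrite -[RHS](subrr (\sum_(l < d.+1) f ((l : nat), (d - l)%N) * r ^+ l * 1 ^+ (d - l))).
  rewrite [in X in _ = _ - X]e -sumrB; apply: eq_bigr => l _.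
  by rewrite expr1n !mulr1 mulrBl.
have := congr1 (fun Q : {poly k} => Q`_i) P0.
rewrite coef_poly ltnS leq_addr coef0 /d addKn => /eqP.
by rewrite subr_eq0 => /eqP.
Qed.

Lemma spec_ab p q (X : ncs k) : spec p q (ab X) = sev p q X.
Proof.
rewrite /spec /ab /subst2 hev_fps_subst; [|exact: erep_mrep|].
  rewrite /sev /hev2; congr (hev _ _ 0 0); apply/funext; apply: wrep_eq; case.
    by rewrite /abB lev_mono /= /erep /= mul1r expr1.
  by rewrite /abA lev_mono /= /erep /= mulr1 expr1.
by case; apply: hom1_mono.
Qed.

Definition scal (u : k) (f : ps k) : ps k := fun d : expo => f d * u ^+ (d : nat).

Lemma spec_eval c p q a b : 
  spec p q (fps_eval c (a *: abA + b *: abB)) = scal (a * p + b * q) c.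
Proof.
apply: psP => d; rewrite /spec hevE lev_fps_eval; first last.
- by apply: hom1D; apply: hom1Z; apply: hom1_mono.
- exact: erep_mrep.
rewrite levD !levZ !lev_mono /= /erep /= mulr1 mul1r !expr1.
rewrite !scale_scalar_mx -raddfD -rmorphXn scale_scalar_mx mxE eqxx mulr1n.
by [].
Qed.
End Specialisation.

(** * The differential equation *)

Section EulerOperator.
Variable k : fieldType.
Implicit Types f g : ps k.

(* h d/dh *)
Definition theta f : ps k := fun d : expo => (d : nat)%:R * f d.

Lemma thetaE f (d : nat) : theta f d = d%:R * f d. Proof. by []. Qed.

Lemma thetaD f g : theta (f + g) = theta f + theta g.
Proof. by apply: psP => d; rewrite psD !thetaE psD mulrDr. Qed.

Lemma thetaN f : theta (- f) = - theta f.
Proof. by apply: psP => d; rewrite psN !thetaE psN mulrN. Qed.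

Lemma thetaM f g : theta (f * g) = theta f * g + f * theta g.
Proof.
apply: psP => d; rewrite psD thetaE !psM mulr_sumr -big_split.
apply: eq_bigr => i _ /=; rewrite !thetaE -{1}(subnKC (leq_ord i)) natrD; ring.
Qed.

Lemma theta_const (c : k) : theta (c%:A) = 0.
Proof. by apply: psP => d; rewrite thetaE ps_const; case: d => [|d]; rewrite ?mul0r ?mulr0. Qed.

Lemma theta0 : theta 0 = 0.
Proof. by apply: psP => d; rewrite thetaE !ps0 mulr0. Qed.

Lemma theta1 : theta 1 = 0.
Proof. by rewrite -[1](scale1r 1) theta_const. Qed.

Lemma theta_hX : theta hX = hX.
Proof.
apply: psP => d; rewrite thetaE -[hX]mulr1 psXM.
by case: d => [|[|d]]; rewrite ?ps1 ?mul1r ?mulr0.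
Qed.

Lemma thetaX f l : theta (f ^+ l) = l%:R * f ^+ l.-1 * theta f.
Proof.
elim: l => [|l IH]; first by rewrite expr0 theta1 !mul0r.
rewrite exprS thetaM IH; case: l {IH} => [|l]; first by rewrite expr0; ring.
by rewrite /= exprS -[l.+2%:R]natr1 -[l.+1%:R]natr1; ring.
Qed.

Hypothesis char0 : [pchar k] =i pred0.

(** As [e] has no constant term, the equation expresses d times the coefficient of degree d through
    the lower ones. *)
Lemma ode_unique f g e : e 0%N = 0 -> f 0%N = g 0%N ->
  theta f = f * e -> theta g = g * e -> f = g.
Proof.
move=> e0 fg0 hf hg; pose w := f - g.
have hw : theta w = w * e by rewrite /w thetaD thetaN hf hg; ring.
suff w0 d : w d = 0.
  by apply/eqP; rewrite -subr_eq0; apply/eqP/psP => d; apply: w0.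
elim/ltn_ind: d => -[_|d IH]; first by rewrite /w psD psN fg0 subrr.
have /eqP := congr1 (fun u : ps k => u d.+1) hw; rewrite thetaE psM big1 => [|i _].
  by rewrite mulf_eq0 (negPf (natr_neq0 char0 d)) => /eqP.
have [id|] := ltnP i d.+1; first by rewrite IH ?mul0r.
by move=> di; rewrite (_ : (d.+1 - i)%N = 0%N) ?e0 ?mulr0 //; apply/eqP; rewrite subn_eq0.
Qed.

Lemma theta_exp (f : fps k expo) : f 0%N = 0 ->
  theta (fps_exp f) = (fps_exp f : ps k) * theta f.
Proof.
move=> f0; apply: psP => d.
have eE N (m : nat) : (m <= N)%N ->
    (fps_exp f : ps k) m = (\sum_(l < N.+1) (l`!%:R)^-1 *: (f : ps k) ^+ l) m.
  move=> hm; rewrite ps_sum.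
  exact: (@fps_evalE _ expo (fun n : expo => (n`!%:R)^-1) f N (m : expo) f0 hm).
(* One term more than degree d requires, because [theta] kills the term l = 0 and lowers the other
   powers by one. *)
transitivity (theta (\sum_(l < d.+2) (l`!%:R)^-1 *: (f : ps k) ^+ l) d).
  by rewrite !thetaE (eE d.+1).
transitivity (((\sum_(l < d.+1) (l`!%:R)^-1 *: (f : ps k) ^+ l) * theta f) d); last first.
  rewrite !psM; apply: eq_bigr => i _; rewrite (eE d) //; exact: leq_ord.
congr (_ d); rewrite (big_morph theta thetaD theta0) big_ord_recl.
rewrite expr0 theta_const add0r mulr_suml; apply: eq_bigr => l _.
rewrite lift0 -[_ *: _]mulr_algl thetaM theta_const mul0r add0r thetaX /=.
rewrite factS natrM invfM.
rewrite mulr_algl mulr_natl -scaler_nat -scalerAl scalerA -scalerAl.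
by rewrite mulrAC mulVf ?mul1r // natr_neq0.
Qed.

Lemma scalM u f g : scal u (f * g) = scal u f * scal u g.
Proof.
apply: psP => d; rewrite /scal !psM mulr_suml; apply: eq_bigr => i _.
have -> : u ^+ d = u ^+ i * u ^+ (d - i) by rewrite -exprD subnKC // leq_ord.
ring.
Qed.

Lemma scalD u f g : scal u (f + g) = scal u f + scal u g.
Proof. by apply: psP => d; rewrite /scal !psD mulrDl. Qed.

Lemma theta_scal u f : theta (scal u f) = scal u (theta f).
Proof. by apply: psP => d; rewrite /scal !thetaE mulrA. Qed.

(** The logarithmic derivative of Gamma under h d/dh. *)
Definition zser (zeta : nat -> k) : ps k :=
  fun d : expo => if (2 <= d)%N then - zeta d else 0.

Definition Gser (zeta : nat -> k) : ps k := Gamma zeta.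

Lemma theta_Gser zeta : theta (Gser zeta) = Gser zeta * zser zeta.
Proof.
rewrite [LHS]theta_exp //; congr (_ * _); apply: psP => d.
rewrite thetaE /zser; case: ifP => // hd; last by rewrite mulr0.
by case: d hd => // d _; rewrite mulrN mulrCA mulfV ?mulr1 // natr_neq0.
Qed.

Lemma Gser0 zeta u : scal u (Gser zeta) 0%N = 1.
Proof.
rewrite /scal mulr1 /Gser /Gamma /fps_exp.
by rewrite (fps_eval_const (fun n : expo => (n`!%:R)^-1)) fact0 invr1.
Qed.

Lemma theta_Gser_scal zeta u :
  theta (scal u (Gser zeta)) = scal u (Gser zeta) * scal u (zser zeta).
Proof. by rewrite theta_scal theta_Gser scalM. Qed.

Lemma Gser_unit zeta u : scal u (Gser zeta) \is a GRing.unit.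
Proof. by rewrite unit_fps [X in X != 0]Gser0 oner_eq0. Qed.

End EulerOperator.

Section CocycleODE.
Variables (k : fieldType) (Phi : ncs k).
Hypothesis char0 : [pchar k] =i pred0.
Hypothesis PhiU : Phi \is a GRing.unit.
Hypothesis PhiG : grouplike Phi.
Hypothesis PhiP : pentagon Phi.

Local Notation F := (Fh Phi).
Local Notation "a %:K" := (a%:A : ps k) (at level 2, format "a %:K").

Definition Fser : fps k (prodm expo expo) := ab (1 + rpartB Phi * serB).

Lemma spec_Fser p q : spec p q Fser = F p q.
Proof. exact: spec_ab. Qed.

Lemma Fh_coef p q (d : nat) :
  F p q d = \sum_(i < d.+1) Fser ((i : nat), (d - i)%N) * p ^+ i * q ^+ (d - i).
Proof. by rewrite -spec_Fser spec_coef. Qed.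

Lemma Fser_sym i j : Fser (i, j) = Fser (j, i).
Proof.
pose f : fps k (prodm expo expo) := fun m => Fser (m.2, m.1).
have specf p q : spec p q f = spec q p Fser.
  apply: psP => d; rewrite !spec_coef (reindex_inj rev_ord_inj) /=.
  apply: eq_bigr => l _; rewrite subSS /f /= subKn; last exact: leq_ord.
  by rewrite mulrAC.
suff e : Fser = f by rewrite {1}e.
apply: (@spec_inj _ char0 _ _ [:: 0]) => p; rewrite inE => p0.
by rewrite specf !spec_Fser Fh_sym ?oner_neq0.
Qed.

(** The degree d part of F at polynomial arguments, so that the cocycle relation can be
    differentiated formally in r. *)
Definition Fpol d (a b : {poly k}) : {poly k} :=
  \sum_(i < d.+1) (Fser ((i : nat), (d - i)%N))%:P * (a ^+ i * b ^+ (d - i)).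

Lemma Fpol_horner d a b r : (Fpol d a b).[r] = F a.[r] b.[r] d.
Proof.
rewrite Fh_coef horner_sum; apply: eq_bigr => i _.
by rewrite !(hornerM, horner_exp, hornerC) mulrA.
Qed.

(* The linear part of [F] in its first variable. *)
Definition Fder (u : k) : ps k := hX * scal u (fun d : expo => Fser (1%N, d : nat)).

Lemma Fpol_derivX d (q : k) : (Fpol d 'X q%:P)^`().[0] = Fder q d.
Proof.
rewrite /Fder psXM raddf_sum /= horner_sum.
transitivity (\sum_(i < d.+1) (if i == 1%N :> nat then
    Fser (1%N, (d - 1)%N) * q ^+ (d - 1) else 0)).
  apply: eq_bigr => i _; rewrite derivM derivC mul0r add0r derivM -polyC_exp derivC.
  rewrite mulr0 addr0 derivXn !(hornerM, hornerC, hornerMn, horner_exp, hornerX).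
  case: eqP => [->|]; first by rewrite expr0 mul1r.
  case: (i : nat) => [|[|l]] // _; first by rewrite mul0r mulr0.
  by rewrite expr0n /= mul0rn mul0r mulr0.
case: d => [|d]; first by rewrite big_ord1.
rewrite (bigD1 (Ordinal (isT : (1 < d.+2)%N))) //= big1 ?addr0; first by rewrite subn1.
by move=> i ne; case: eqP => // e; case/eqP: ne; apply: val_inj.
Qed.

Lemma Fpol_deriv_shift d (p q : k) :
  q * (Fpol d p%:P (q%:P + 'X))^`().[0] =
  \sum_(i < d.+1) (d - i)%N%:R * (Fser ((i : nat), (d - i)%N) * p ^+ i * q ^+ (d - i)).
Proof.
rewrite raddf_sum /= horner_sum mulr_sumr; apply: eq_bigr => i _.
rewrite derivM derivC mul0r add0r derivM -polyC_exp derivC mul0r add0r deriv_exp.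
rewrite derivD derivC derivX add0r.
rewrite !(hornerM, hornerC, hornerMn, horner_exp, hornerX, hornerD) addr0 mul1r.
by case: (d - i)%N => [|n]; rewrite ?mulr0n ?mul0r ?mulr0 // -mulr_natl exprS /=; ring.
Qed.

(** The left side is b dF/db at (p h, q h). The identity is the derivative of the cocycle relation
    at r = 0, where F(0, q) = 1. *)
Lemma Fh_partial p q : q != 0 -> p + q != 0 ->
  (fun d : expo => \sum_(i < (d : nat).+1) (d - i)%N%:R *
     (Fser ((i : nat), (d - i)%N) * p ^+ i * q ^+ (d - i))) =
  q%:K * (F p q * (Fder (p + q) - Fder q)) :> ps k.
Proof.
move=> q0 pq0.
pose D : ps k := fun d : expo => (Fpol d p%:P (q%:P + 'X))^`().[0].
have -> : (fun d : expo => \sum_(i < (d : nat).+1) (d - i)%N%:R *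
     (Fser ((i : nat), (d - i)%N) * p ^+ i * q ^+ (d - i))) = q%:K * D :> ps k.
  by apply: psP => d; rewrite mulr_algl psZ Fpol_deriv_shift.
congr (_ * _); suff e : Fder q * F p q + D = F p q * Fder (p + q).
  by rewrite mulrBr -e; ring.
apply: psP => d.
(* The difference of the two sides in degree d, as a polynomial in r. The cocycle relation makes it
   vanish except possibly at r = - q and r = - (p + q), hence identically. *)
pose P := \sum_(i < d.+1) Fpol i 'X q%:P * Fpol (d - i) p%:P (q%:P + 'X) -
  \sum_(i < d.+1) Fpol i p%:P q%:P * Fpol (d - i) 'X (p + q)%:P.
have P0 : P = 0.
  apply: (@poly_cofinite0 _ char0 _ [:: - q; - (p + q)]) => r.
  rewrite !inE negb_or => /andP[r1 r2]; rewrite hornerD hornerN !horner_sum.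
  have qr : q + r != 0 by apply: contraNneq r1 => e; rewrite -[r](addKr q) e addr0.
  have pqr : p + q + r != 0.
    by apply: contraNneq r2 => e; rewrite -[r](addKr (p + q)) e addr0.
  have := congr1 (fun u : ps k => u d) (Fh_cocycle PhiU PhiG PhiP q0 pq0 qr pqr).
  rewrite !psM => e; apply/eqP; rewrite subr_eq0; apply/eqP.
  transitivity (\sum_(i < d.+1) F r q i * F p (q + r) (d - i)%N).
    by apply: eq_bigr => i _; rewrite hornerM !Fpol_horner !(hornerC, hornerX, hornerD).
  rewrite e; apply: eq_bigr => i _.
  by rewrite hornerM !Fpol_horner !(hornerC, hornerX, hornerD).
have := congr1 (fun Q : {poly k} => Q^`().[0]) P0.
rewrite derivB hornerD hornerN deriv0 hornerC !raddf_sum /= !horner_sum => /eqP.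
rewrite subr_eq0 => /eqP e.
have Dc i : (Fpol i p%:P q%:P)^`() = 0.
  rewrite raddf_sum /= big1 // => l _.
  by rewrite derivM derivC mul0r add0r -!polyC_exp -polyCM derivC mulr0.
rewrite psD !psM -[D]mul1r -(Fh0q PhiU PhiG PhiP q) psM -big_split /=.
transitivity (\sum_(i < d.+1) (Fpol i 'X q%:P * Fpol (d - i) p%:P (q%:P + 'X))^`().[0]).
  apply: eq_bigr => i _; rewrite derivM hornerD !hornerM Fpol_derivX !Fpol_horner.
  by rewrite !(hornerC, hornerX, hornerD) addr0.
rewrite e; apply: eq_bigr => i _.
rewrite derivM hornerD !hornerM Dc hornerC mul0r add0r Fpol_derivX !Fpol_horner.
by rewrite !hornerC.
Qed.

(** The part of Gamma(a + b) / (Gamma(a) Gamma(b)) linear in a is - sum_n zeta(n) a b^(n - 1), which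
    forces this choice. *)
Definition zetaF (n : nat) : k := - Fser (1%N, n.-1).

Lemma zser_zetaF u : scal u (zser zetaF) = u%:K * Fder u.
Proof.
apply: psP => d; rewrite mulr_algl psZ /Fder psXM /scal /zser /zetaF opprK.
case: d => [|[|d]] /=; rewrite ?mul0r ?mulr0 //.
  (* In degree 1 [zser] is 0, so the coefficient of a in F has to vanish; by symmetry it is that of
     b, and F(0, q) = 1. *)
  rewrite Fser_sym; suff -> : Fser (0%N, 1%N) = 0 by rewrite mul0r mulr0.
  have := congr1 (fun f : ps k => f 1%N) (Fh0q PhiU PhiG PhiP 1).
  rewrite Fh_coef ps1 !big_ord_recl big_ord0 !addr0 /= !expr0 !expr1n.
  by rewrite !mulr1 expr1 mulr0 addr0.
by rewrite [u ^+ d.+2]exprS mulrCA.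
Qed.

(** h d/dh is a d/da + b d/db on the two arguments; [Fh_partial] gives the second term, and the
    first one by symmetry. *)
Lemma theta_Fh p q : p != 0 -> q != 0 -> p + q != 0 ->
  theta (F p q) =
  F p q * (scal (p + q) (zser zetaF) - scal p (zser zetaF) - scal q (zser zetaF)).
Proof.
move=> p0 q0 pq0; have e1 := Fh_partial q0 pq0.
have qp0 : q + p != 0 by rewrite addrC.
have e2 := Fh_partial p0 qp0.
transitivity (p%:K * (F q p * (Fder (q + p) - Fder p)) +
              q%:K * (F p q * (Fder (p + q) - Fder q))); last first.
  by rewrite !zser_zetaF (Fh_sym PhiU PhiG PhiP q0 p0) [q + p]addrC scalerDl; ring.
rewrite -e1 -e2; apply: psP => d; rewrite thetaE psD Fh_coef.
rewrite [X in _ = X + _](reindex_inj rev_ord_inj) /= mulr_sumr -big_split /=.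
apply: eq_bigr => i _; rewrite subSS subKn ?leq_ord // [Fser ((d - i)%N, _)]Fser_sym.
have -> : d%:R = i%:R + (d - i)%:R :> k by rewrite -natrD subnKC // leq_ord.
ring.
Qed.

Lemma Fh_deg0 p q : F p q 0%N = 1.
Proof.
rewrite /Fh sev_deg0 /counit Defs.coefD Defs.coef1 eqxx.
by rewrite [(_ * _ : ncs k) _]coefM_letter0 addr0.
Qed.

Lemma Fh_Gser p q : p != 0 -> q != 0 -> p + q != 0 ->
  F p q * (scal p (Gser zetaF) * scal q (Gser zetaF)) = scal (p + q) (Gser zetaF).
Proof.
move=> p0 q0 pq0; apply: (@ode_unique _ char0 _ _ (scal (p + q) (zser zetaF))).
- by rewrite /scal /zser mul0r.
- by rewrite Gser0 !psM !big_ord1 !psM !big_ord1 !Gser0 Fh_deg0 !mulr1.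
- rewrite thetaM [theta (scal p _ * _)]thetaM theta_Fh // !theta_Gser_scal //; ring.
- exact: theta_Gser_scal.
Qed.

Lemma spec_Gamma (zeta : nat -> k) p q :
  [/\ spec p q (fps_eval (Gamma zeta) abA) = scal p (Gser zeta),
      spec p q (fps_eval (Gamma zeta) abB) = scal q (Gser zeta)
    & spec p q (fps_eval (Gamma zeta) (abA + abB)) = scal (p + q) (Gser zeta)].
Proof.
have h a b := spec_eval (Gamma zeta) p q a b; split.
- by have := h 1 0; rewrite scale1r scale0r !addr0 mul1r mul0r addr0.
- by have := h 0 1; rewrite scale1r scale0r !add0r mul1r mul0r add0r.
- by have := h 1 1; rewrite !scale1r !mul1r.
Qed.

Lemma Gamma_factorization_Fh (zeta : nat -> k) p q : Gamma_factorization Phi zeta ->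
  F p q * (scal p (Gser zeta) * scal q (Gser zeta)) = scal (p + q) (Gser zeta).
Proof.
have [hA hB hAB] := spec_Gamma zeta p q.
rewrite /Gamma_factorization -/Fser => h.
rewrite -hAB -hA -hB -spec_Fser -!specM h mulrVK //.
by rewrite unitrMl ?unit_Gamma.
Qed.

Lemma Gamma_factorization_zetaF : Gamma_factorization Phi zetaF.
Proof.
rewrite /Gamma_factorization -/Fser; apply: (canRL (mulrK _)).
  by rewrite unitrMl ?unit_Gamma.
(* The excluded values are those for which p or p + 1 vanishes. *)
apply: (@spec_inj _ char0 _ _ [:: 0; -1]) => p; rewrite !inE negb_or => /andP[p0 p1].
have [hA hB hAB] := spec_Gamma zetaF p 1.
rewrite !specM hA hB hAB spec_Fser Fh_Gser ?oner_neq0 //.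
by apply: contraNneq p1 => e; rewrite -[p](addrK 1) e sub0r.
Qed.

Lemma pow2_sub2 n : (2 <= n)%N -> 2 ^+ n - 2 != 0 :> k.
Proof.
case: n => [|[|n]] // _; rewrite -natrX -natrB; last first.
  by rewrite expnS leq_pmulr // expn_gt0.
rewrite ((pcharf0P k).1 char0) subn_eq0 -ltnNge expnS.
by rewrite -[X in (X < _)%N]muln1 ltn_pmul2l // -[X in (X < _)%N](expn0 2) ltn_exp2l.
Qed.

(** In degree n the logarithmic derivative of F(1, 1) is - (2^n - 2) zeta(n), and 2^n - 2 is nonzero
    for n >= 2. *)
Lemma Gamma_factorization_uniq (zeta zeta' : nat -> k) :
  Gamma_factorization Phi zeta -> Gamma_factorization Phi zeta' ->
  forall n, (2 <= n)%N -> zeta n = zeta' n.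
Proof.
move=> h h' n hn.
have th z : Gamma_factorization Phi z ->
    theta (F 1 1) = F 1 1 * (scal (1 + 1) (zser z) - scal 1 (zser z) - scal 1 (zser z)).
  move=> hz; have fz := Gamma_factorization_Fh 1 1 hz.
  have := congr1 (@theta k) fz.
  rewrite thetaM [theta (scal 1 _ * _)]thetaM !theta_Gser_scal // -fz => e.
  apply: (mulIr (Gser_unit z 1)); apply: (mulIr (Gser_unit z 1)).
  move: e => /(canRL (addrK _)); rewrite -!mulrA => ->; ring.
have FU : F 1 1 \is a GRing.unit by rewrite unit_fps [X in X != 0]Fh_deg0 oner_eq0.
have := etrans (esym (th _ h)) (th _ h') => /(mulrI FU)/(congr1 (fun f : ps k => f n)).
rewrite !(psD, psN) /scal /zser hn expr1n !mulr1 -[1 + 1]/(2%:R) => e.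
apply: (mulfI (pow2_sub2 hn)); apply: oppr_inj.
transitivity (- zeta n * 2 ^+ n - - zeta n - - zeta n); first ring.
rewrite e; ring.
Qed.
End CocycleODE.

(** * The hexagon and the Bernoulli numbers *)

Section RationalImage.
Variable k : fieldType.
Hypothesis char0 : [pchar k] =i pred0.

Lemma intr_eq0_char0 (m : int) : (m%:~R == 0 :> k) = (m == 0).
Proof.
by case: m => n; rewrite ?NegzE ?mulrNz ?oppr_eq0 -?pmulrn ((pcharf0P k).1 char0).
Qed.

(** Clearing denominators reduces identities between rationals to identities between integers, and
    denominators stay nonzero in k. The compatibility of [ratr] with sums and products follows. *)
Lemma ratr_frac (x : rat) (n d : int) : x * d%:~R = n%:~R -> ratr x * d%:~R = n%:~R :> k.
Proof.
move=> h; have dx0 : (denq x)%:~R != 0 :> k by rewrite intr_eq0_char0 denq_neq0.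
have e : numq x * d = n * denq x.
  apply: (@intr_inj rat); rewrite !rmorphM /= -h mulrAC; congr (_ * _).
  by rewrite -{2}[x]divq_num_den divfK // intr_eq0 denq_neq0.
apply: (mulfI dx0); rewrite /ratr mulrA [_ * (_ / _)]mulrC divfK //.
by rewrite -rmorphM e rmorphM mulrC.
Qed.

Lemma ratr_num_den (x : rat) : ratr x * (denq x)%:~R = (numq x)%:~R :> k.
Proof. by rewrite /ratr divfK // intr_eq0_char0 denq_neq0. Qed.

Lemma rat_num_den (x : rat) : x * (denq x)%:~R = (numq x)%:~R.
Proof. by rewrite -{1}[x]divq_num_den divfK // intr_eq0 denq_neq0. Qed.

Lemma ratr_addE (x y : rat) : ratr (x + y) = ratr x + ratr y :> k.
Proof.
have d0 z : (denq z)%:~R != 0 :> k by rewrite intr_eq0_char0 denq_neq0.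
apply: (mulIf (d0 y)); apply: (mulIf (d0 x)).
have := @ratr_frac (x + y) (numq x * denq y + numq y * denq x) (denq y * denq x).
rewrite !rmorphD !rmorphM /= -!rat_num_den => h.
rewrite -mulrA h; last by ring.
by rewrite -!ratr_num_den; ring.
Qed.

Lemma ratr_mulE (x y : rat) : ratr (x * y) = ratr x * ratr y :> k.
Proof.
have d0 z : (denq z)%:~R != 0 :> k by rewrite intr_eq0_char0 denq_neq0.
apply: (mulIf (d0 y)); apply: (mulIf (d0 x)).
have := @ratr_frac (x * y) (numq x * numq y) (denq y * denq x).
rewrite !rmorphM /= -!rat_num_den => h.
rewrite -mulrA h; last by ring.
by rewrite -!ratr_num_den; ring.
Qed.

Lemma ratr_natE (n : nat) : ratr (n%:R) = n%:R :> k.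
Proof. exact: ratr_nat. Qed.

Lemma ratr_sumE (I : Type) (r : seq I) (P : pred I) (E : I -> rat) :
  ratr (\sum_(i <- r | P i) E i) = \sum_(i <- r | P i) ratr (E i) :> k.
Proof. by apply: (big_morph (@ratr k)); [exact: ratr_addE|exact: (ratr_natE 0)]. Qed.

Lemma ratr_oppE (x : rat) : ratr (- x) = - ratr x :> k.
Proof. by apply: (addIr (ratr x)); rewrite -ratr_addE !addNr (ratr_natE 0). Qed.

Lemma ratr_invE (n : nat) : ratr (n%:R^-1) = n%:R^-1 :> k.
Proof.
case: n => [|n]; first by rewrite !invr0 (ratr_natE 0).
have n0 := natr_neq0 char0 n; apply: (mulIf n0).
rewrite mulVf // -ratr_natE -ratr_mulE mulVf ?(ratr_natE 1) //.
by rewrite Num.Theory.pnatr_eq0.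
Qed.
End RationalImage.

Section Exponential.
Variable k : fieldType.
Hypothesis char0 : [pchar k] =i pred0.
Local Notation "a %:K" := (a%:A : ps k) (at level 2, format "a %:K").

(* exp (t h) *)
Definition Ex (t : k) : ps k := fun d : expo => t ^+ (d : nat) / (d : nat)`!%:R.

Lemma Ex_deg0 t : Ex t 0%N = 1.
Proof. by rewrite /Ex fact0 divr1. Qed.

Lemma theta_Ex t : theta (Ex t) = Ex t * (t%:K * hX).
Proof.
apply: psP => d; rewrite [Ex t * _]mulrC -mulrA mulr_algl psZ psXM thetaE /Ex.
case: d => [|d]; first by rewrite mul0r mulr0.
rewrite factS natrM exprS invfM mulrCA [d.+1%:R * _]mulrA divff ?natr_neq0 //.
by rewrite mul1r mulrA.
Qed.

Lemma ExD s t : Ex (s + t) = Ex s * Ex t.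
Proof.
apply: (@ode_unique _ char0 _ _ ((s + t)%:K * hX)).
- by rewrite mulr_algl psZ /hX /mono mulr0.
- by rewrite psM big_ord1 !Ex_deg0 mulr1.
- exact: theta_Ex.
- by rewrite thetaM !theta_Ex scalerDl; ring.
Qed.

Lemma scal_Ex u t : scal u (Ex t) = Ex (u * t).
Proof. by apply: psP => d; rewrite /scal /Ex exprMn; ring. Qed.

Lemma Ex_unit t : Ex t \is a GRing.unit.
Proof. by rewrite unit_fps [X in X != 0]Ex_deg0 oner_eq0. Qed.

Definition bser : ps k := fun n : expo => ratr (bernoulli n) / (n : nat)`!%:R.

Lemma bser_genfun : bser * (Ex 1 - 1) = hX.
Proof.
apply: psP => d; rewrite psM.
have := congr1 (fun f : fps rat expo => ratr (f d) : k) bernoulli_genfun.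
rewrite /= (@psM rat) ratr_sumE // => e.
have -> : hX d = ratr (mono (1%N : expo) (d : expo)) :> k.
  by rewrite /hX /mono; case: (_ == _); rewrite ratr_natE.
rewrite -e; apply: eq_bigr => i _; rewrite ratr_mulE // ratr_mulE // ratr_invE //.
congr (_ * _); move: (d - i)%N => n.
rewrite psD psN ps1 /Ex expr1n mul1r.
have -> : (fps_exp (mono (1%N : expo)) - 1 : fps rat expo) (n : expo) =
    (n`!%:R)^-1 - (n == 0%N)%:R.
  rewrite Defs.coefD Defs.coefN Defs.coef1; congr (_ - _).
  rewrite /fps_exp /fps_eval; under eq_bigr do rewrite expr_mono1.
  rewrite (bigD1 ord_max) //= eqxx mulr1 big1 ?addr0 // => l ne.
  rewrite (_ : (_ == _) = false) ?mulr0 //; apply/negbTE.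
  by apply: contra_neq ne => e'; apply: val_inj.
by rewrite ratr_addE // ratr_oppE // ratr_invE // ratr_natE.
Qed.
End Exponential.

Section Hexagon.
Variables (k : fieldType) (lambda : k) (Phi : ncs k).
Hypothesis char0 : [pchar k] =i pred0.
Hypothesis lambda_neq0 : lambda != 0.
Hypothesis PhiU : Phi \is a GRing.unit.
Hypothesis PhiG : grouplike Phi.
Hypothesis PhiP : pentagon Phi.
Hypothesis PhiH : hexagon lambda Phi.

Local Notation F := (Fh Phi).
Local Notation "a %:K" := (a%:A : ps k) (at level 2, format "a %:K").

Lemma hev2_subst2 n (A B : 'M[k]_n) (X x y : ncs k) : hom1 x -> hom1 y ->
  hev2 A B (subst2 X x y) =
  hev2 (lev (wrep (pairrep A B)) 1 x) (lev (wrep (pairrep A B)) 1 y) X.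
Proof.
move=> hx hy; rewrite /hev2 /subst2 hev_fps_subst; first last.
- by case.
- exact: wrep_mrep.
by apply: hev_eq; apply: wrep_eq; case.
Qed.

Lemma aff_exp (a s : k) d : aff a s ^+ d.+1 = a ^+ d *: aff a s.
Proof.
elim: d => [|d IH]; first by rewrite expr1 expr0 scale1r.
rewrite exprS IH -mulmxE -scalemxAr; apply/matrixP; do 2 (apply: ord2);
  rewrite !mxE sum2 !mxE /= ?exprS; ring.
Qed.

(** The exponential is the homothety of ratio e^(c a h) about the fixed point - s / a. *)
Lemma hev2_exp_aff (A B : 'M[k]_2) (x : ncs k) (c a s : k) (v : ps k) : a != 0 -> hom1 x ->
  lev (wrep (pairrep A B)) 1 x = aff a s ->
  hev2 A B (fps_exp (c *: x)) *m vec2 v 1 =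
    vec2 (Ex (c * a) * v + (s / a)%:K * (Ex (c * a) - 1)) 1.
Proof.
move=> a0 hx xE; set H := hev2 _ _ _.
have HE i j (d : nat) : H i j d = (d`!%:R)^-1 * (((c *: aff a s) ^+ d) i j).
  rewrite /H hevE lev_fps_eval; [|exact: wrep_mrep|exact: hom1Z].
  by rewrite levZ xE mxE.
have HS i j (d : nat) : H i j d.+1 = (d.+1`!%:R)^-1 * (c ^+ d.+1 * a ^+ d * aff a s i j).
  by rewrite HE exprZn aff_exp scalerA mxE.
rewrite mulmx_vec2; congr vec2.
  have -> : H 0 0 = Ex (c * a).
    apply: psP => -[|d]; first by rewrite HE expr0 mxE fact0 invr1 mulr1 Ex_deg0.
    by rewrite HS mxE /= /Ex exprMn [a ^+ d.+1]exprSr; ring.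
  have -> : H 0 1 = (s / a)%:K * (Ex (c * a) - 1); last by rewrite mulr1.
  apply: psP => -[|d]; rewrite mulr_algl psZ psD psN ps1.
    by rewrite HE expr0 mxE Ex_deg0 subrr !mulr0.
  rewrite HS mxE /= subr0 /Ex exprMn [a ^+ d.+1]exprSr.
  rewrite [in RHS]mulrC -!mulrA [a * (_ * _)]mulrCA [a * _]mulrCA divff // mulr1.
  ring.
have -> : H 1 0 = 0.
  apply: psP => -[|d]; first by rewrite HE expr0 mxE mulr0.
  by rewrite HS mxE /= !mulr0.
have -> : H 1 1 = 1; last by rewrite mul0r mul1r add0r.
apply: psP => -[|d]; first by rewrite HE expr0 mxE fact0 invr1 mulr1.
by rewrite HS mxE /= !mulr0.
Qed.

(** Take A, B and C = - A - B as affine maps with slopes 1, 1, -2 and fixed points 0, -1, -1/2, and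
    follow the point 0 through the six factors of the hexagon: its total displacement is 0. *)
Lemma hexagon_Fh : 2 * F 1 1 =
  Ex (- (lambda / 2)) * F 1 (-2) + Ex (lambda / 2) * F (-2) 1.
Proof.
have n2 : 2 != 0 :> k := natr_neq0 char0 1.
pose A : 'M[k]_2 := aff 1 0; pose B : 'M[k]_2 := aff 1 1.
have lA : lev (wrep (pairrep A B)) 1 serA = aff 1 0 by exact: lev_letter.
have lB : lev (wrep (pairrep A B)) 1 serB = aff 1 1 by exact: lev_letter.
have hA : hom1 (serA : ncs k) by exact: hom1_letter.
have hB : hom1 (serB : ncs k) by exact: hom1_letter.
have hC : hom1 (- serA - serB : ncs k) by apply: hom1D; apply: hom1N.
have lC : lev (wrep (pairrep A B)) 1 (- serA - serB) = aff (-2) (-1).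
  rewrite levD !levN lA lB; apply/matrixP; do 2 (apply: ord2); rewrite !mxE /=; ring.
have := congr1 (fun X => hev2 A B X *m vec2 0 1) PhiH.
rewrite hev2_one mul1mx !hev2M !hev2_subst2 // lA lB lC -!mulmxA.
have m2 : -2 != 0 :> k by rewrite oppr_eq0.
rewrite (hev2_exp_aff _ _ _ hB lB) ?oner_neq0 //.
(* In each use of [hev2_affine] the last argument is the fixed point of the first letter: here that
   of B, then those of C and A. *)
rewrite (@hev2_affine _ _ PhiU PhiG PhiP 1 (-2) 1 (-1) (-1)) ?mulrN1 //.
rewrite (hev2_exp_aff _ _ m2 hC lC).
rewrite (@hev2_affine _ _ PhiU PhiG PhiP (-2) 1 (-1) 0 (- 2^-1)) ?oner_neq0 //; last first.
  by rewrite mulrNN opprK divff.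
rewrite (hev2_exp_aff _ _ _ hA lA) ?oner_neq0 //.
rewrite (@hev2_affine _ _ PhiU PhiG PhiP 1 1 0 1 0) ?oner_neq0 ?mulr0 ?oppr0 //.
move=> /vec2K[e _].
set E := Ex (lambda / 2) in e *; set En := Ex (- (lambda / 2)).
have EEn : E * En = 1.
  rewrite -ExD // subrr; apply: psP => d; rewrite ps1 /Ex expr0n.
  by case: d => [|d]; rewrite ?fact0 ?divr1 ?mul0r.
have Em : Ex (lambda / 2 * -2) = En * En by rewrite -ExD //; congr Ex; ring.
pose H : ps k := (2^-1)%:K.
have H2 : 2 * H = 1 by rewrite mulr_natl -scaler_nat scalerA divff // scale1r.
move: e; rewrite mulr1 -/E Em divr1 mul0r !mul1r !add0r !addr0 !divr1 opprK.
rewrite (_ : (2 - 1) / -2 = - 2^-1); last by rewrite invrN; ring.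
rewrite (_ : -1 / -2 = 2^-1); last by rewrite invrN; ring.
rewrite scaleNr -/H !scale0r !scale1r => e.
have {}e : 1 - En - En * H * (F 1 (-2) - 1) + H * (En - E)
    - H * E * (F (-2) 1 - 1) + (F 1 1 - 1) = 0.
  rewrite -{}[RHS]e.
  (* This is the displacement before the simplification E En = 1. *)
  transitivity (E * En * (E * En) - E * En * En - E * En * En * H * (F 1 (-2) - 1)
    + H * (E * En * En - E) - H * E * (F (-2) 1 - 1) + (F 1 1 - 1)); last by ring.
  by rewrite EEn !mul1r.
apply/eqP; rewrite -subr_eq0; apply/eqP.
transitivity (2 * (1 - En - En * H * (F 1 (-2) - 1) + H * (En - E)
    - H * E * (F (-2) 1 - 1) + (F 1 1 - 1))); last by rewrite e mulr0.
transitivity (2 * (F 1 1 - En) + 2 * H * (En - E - En * (F 1 (-2) - 1) - E * (F (-2) 1 - 1))).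
  by rewrite H2; ring.
ring.
Qed.

Variable zeta : nat -> k.
Hypothesis hzeta : Gamma_factorization Phi zeta.

Local Notation G u := (scal u (Gser zeta)).

Lemma scal_comp u v (f : ps k) : scal u (scal v f) = scal (u * v) f.
Proof. by apply: psP => d; rewrite /scal exprMn; ring. Qed.

Lemma scal_hX u : scal u hX = u%:K * hX.
Proof.
apply: psP => d; rewrite mulr_algl psZ /scal /hX /mono.
by case: d => [|[|d]]; rewrite ?expr1 /= ?mulr1 ?mul1r ?mulr0 ?mul0r.
Qed.

Lemma scal_const u (c : k) : scal u c%:K = c%:K.
Proof.
apply: psP => d; rewrite /scal !ps_const.
by case: d => [|d]; rewrite ?expr0 ?mulr1 // mulr0 mul0r.
Qed.

Lemma scalN1 u (f : ps k) : scal u (f - 1) = scal u f - 1.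
Proof.
rewrite scalD; congr (_ + _); apply: psP => d; rewrite /scal !psN ps1.
by case: d => [|d]; rewrite ?expr0 ?mulr1 // oppr0 mul0r.
Qed.

(** Replace each F(p, q) in the hexagon by G(p + q) / (G(p) G(q)), after multiplying by G(1)^2
    G(-2). *)
Lemma reflection : 2 * scal 2 (G 1 * G (-1)) =
  (Ex (- (lambda / 2)) + Ex (lambda / 2)) * (G 1 * G (-1)).
Proof.
have hF p q := Gamma_factorization_Fh p q hzeta.
have h1 := hF 1 1; have h2 := hF 1 (-2); have h3 := hF (-2) 1.
rewrite scalM !scal_comp mulr1 mulrN1 -[1 + 1]/(2 : k) in h1 *.
have e : 1 - 2 = -1 :> k by ring.
rewrite e in h2; rewrite addrC e in h3.
transitivity (2 * F 1 1 * G 1 * G 1 * G (-2)); first by rewrite -h1; ring.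
transitivity (Ex (- (lambda / 2)) * (F 1 (-2) * (G 1 * G (-2))) * G 1 +
  Ex (lambda / 2) * (F (-2) 1 * (G (-2) * G 1)) * G 1).
  by rewrite hexagon_Fh; ring.
by rewrite h2 h3; ring.
Qed.

(** Both sides satisfy f(2 h) = f(h) (e^(lambda h) + 1) and agree up to degree 1. In degree n >= 2
    this equation determines the coefficient, since 2^n - 2 is nonzero. *)
Lemma reflection_sinh :
  lambda%:K * hX * Ex (lambda / 2) * (G 1 * G (-1)) = Ex lambda - 1.
Proof.
set P := G 1 * G (-1); set Q := (X in X = _).
pose W := Q - (Ex lambda - 1).
have El : Ex lambda = Ex (lambda / 2) * Ex (lambda / 2).
  by rewrite -ExD //; congr Ex; field; apply: natr_neq0 char0 1.
have EEn : Ex (lambda / 2) * Ex (- (lambda / 2)) = 1.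
  rewrite -ExD // subrr; apply: psP => d; rewrite ps1 /Ex expr0n.
  by case: d => [|d]; rewrite ?fact0 ?divr1 ?mul0r.
have sQ : scal 2 Q = Q * (Ex lambda + 1).
  rewrite /Q !scalM scal_Ex scal_const scal_hX -scalM -/P.
  rewrite (_ : 2 * (lambda / 2) = lambda); last by field; apply: natr_neq0 char0 1.
  have -> : 2%:K = 2 :> ps k by rewrite scaler_nat.
  transitivity (lambda%:K * hX * Ex lambda * (2 * scal 2 P)); first by ring.
  rewrite reflection -/P El.
  transitivity (lambda%:K * hX * P * Ex (lambda / 2) *
    (Ex (lambda / 2) * Ex (- (lambda / 2)) + Ex (lambda / 2) * Ex (lambda / 2)));
    first by ring.
  by rewrite EEn; ring.
have sW : scal 2 W = W * (Ex lambda + 1).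
  rewrite /W scalD sQ (_ : scal 2 (- (Ex lambda - 1)) = - (scal 2 (Ex lambda - 1))).
    rewrite scalN1 scal_Ex (_ : 2 * lambda = lambda + lambda); last by ring.
    by rewrite ExD //; ring.
  by apply: psP => d; rewrite /scal !psN mulNr.
suff W0 d : W d = 0.
  by apply/eqP; rewrite -subr_eq0; apply/eqP/psP => d; apply: W0.
have QX : Q = hX * (lambda%:K * (Ex (lambda / 2) * P)) by rewrite /Q; ring.
have psM0 (f g : ps k) : (f * g) 0%N = f 0%N * g 0%N by rewrite psM big_ord1.
elim/ltn_ind: d => -[|[|d]] IH.
- rewrite /W psD psN psD psN ps1 Ex_deg0 subrr subr0 QX.
  exact: psXM.
- rewrite /W psD psN psD psN ps1 subr0 QX.
  have -> : (hX * (lambda%:K * (Ex (lambda / 2) * P))) 1%N = lambda.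
    by rewrite [LHS]psXM mulr_algl psZ psM0 Ex_deg0 mul1r /P psM0 !Gser0 !mulr1.
  by rewrite /Ex expr1 divr1 subrr.
(* By induction only the top coefficient of W survives in the product, times the constant term 2 of
   e^(lambda h) + 1. *)
have := congr1 (fun f : ps k => f d.+2) sW; rewrite /scal psM big_ord_recr /= big1.
  rewrite add0r subnn psD Ex_deg0 ps1 eqxx => /eqP.
  rewrite -subr_eq0 -mulrBr mulf_eq0 => /orP[/eqP //|].
  by rewrite (negPf (pow2_sub2 char0 _)).
by move=> i _; rewrite IH ?mul0r // ltn_ord.
Qed.

(** The logarithmic derivative of e^(lambda h) - 1 is computed in two ways: from [reflection_sinh],
    and as lambda h plus the Bernoulli series at lambda h. In even degree n this reads - 2 zeta(n) =
    lambda^n B_n / n!. *)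
Lemma zeta_even n : (2 <= n)%N -> ~~ odd n -> zeta n = lambda ^+ n * ratr (rnum n).
Proof.
move=> hn on.
pose V := lambda%:K * Ex (lambda / 2) * (G 1 * G (-1)).
have VU : V \is a GRing.unit.
  by rewrite /V !unitrM unit_const // Ex_unit // !Gser_unit.
have Q := reflection_sinh.
have VE : hX * V = Ex lambda - 1 by rewrite -Q /V; ring.
pose z u := scal u (zser zeta).
have t1 : theta (Ex lambda - 1) = hX * V * (1 + (lambda / 2)%:K * hX + z 1 + z (-1)).
  rewrite -VE /V !thetaM theta_hX theta_const theta_Ex // !theta_Gser_scal // /z; ring.
have t2 : theta (Ex lambda - 1) = hX * V * (lambda%:K * hX + scal lambda (bser k)).
  have hb : scal lambda (bser k) * (Ex lambda - 1) = lambda%:K * hX.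
    by rewrite -scal_hX -(bser_genfun char0) scalM scalN1 scal_Ex mulr1.
  rewrite mulrDr [_ * scal _ _]mulrC VE hb thetaD thetaN theta1 theta_Ex // subr0.
  ring.
have cancelX (f g : ps k) : hX * f = hX * g -> f = g.
  move=> e; apply: psP => d; have := congr1 (fun u : ps k => u d.+1) e.
  by rewrite !psXM.
have e := etrans (esym t1) t2; rewrite -[LHS]mulrA -[RHS]mulrA in e.
have {}e := mulrI VU (cancelX _ _ e).
have := congr1 (fun f : ps k => f n) e.
rewrite !psD ps1 !mulr_algl !psZ /z /scal /zser hn /hX /mono.
have -> : (n == 0%N) = false by case: (n) hn.
have -> : (n == 1%N :> expo) = false by case: (n) hn => [|[|]].
rewrite !mulr0 !add0r expr1n mulr1 -signr_odd (negPf on) expr0 mulr1 /bser => {}e.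
have n2 := natr_neq0 char0 1.
rewrite /rnum ratr_mulE // ratr_oppE // -natrM ratr_invE // natrM.
apply: (mulIf n2); apply: oppr_inj.
transitivity (- zeta n - zeta n); first by ring.
rewrite e; field.
by rewrite n2 andbT ((pcharf0P k).1 char0) -lt0n fact_gt0.
Qed.
End Hexagon.

Theorem corollary0p4 (k : fieldType) (char0 : [pchar k] =i pred0)
    (lambda : k) (lambda_neq0 : lambda != 0)
    (Phi : fps k (word bool)) (hPhi : Assoc lambda Phi) :
  exists zeta : nat -> k,
    [/\ Gamma_factorization Phi zeta,
        forall zeta' : nat -> k, Gamma_factorization Phi zeta' ->
          forall n : nat, (2 <= n)%N -> zeta' n = zeta n
      & forall n : nat, (2 <= n)%N -> ~~ odd n ->
          zeta n = lambda ^+ n * ratr (rnum n)].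
Proof.
case: hPhi => PhiU PhiG PhiH PhiP.
have hz := Gamma_factorization_zetaF char0 PhiU PhiG PhiP.
exists (zetaF Phi); split=> // [zeta' hz' n hn|n hn on].
  exact: Gamma_factorization_uniq hz' hz n hn.
exact: (zeta_even char0 lambda_neq0 PhiU PhiG PhiP PhiH hz hn on).
Qed.
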